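(* Let $n\ge1$ and let $q\in k^\times$ be a primitive $\ell$-th root of unity with $\ell$ odd. Any simple left $D(\bar{\mathscr A}_q(n))$-module has the form (i.e. is isomorphic to) $\bar{\mathscr A}_{\alpha,\beta}:=\big(\bar{\mathscr A}_q(n)\big)_{\mathcal K(\alpha),K(\beta)}$ for some $\alpha,\beta\in\Lambda_+^{\le\kappa}$.
   Context: Throughout, $k$ is an algebraically closed field of characteristic $0$. **Lattice notation.** $\Lambda=\bigoplus_{i=1}^n\mathbb Z\epsilon_i$ is the free abelian group with standard basis $\epsilon_1,\dots,\epsilon_n$. For $\alpha,\beta\in\Lambda$: $\alpha*\beta=\sum_{j=1}^{n-1}\sum_{i>j}\alpha_i\beta_j$, $\theta(\alpha,\beta)=q^{\alpha*\beta-\beta*\alpha}$, $\langle\alpha,\beta\rangle=\sum_i\alpha_i\beta_i$. Put $\kappa=(\ell-1,\dots,\ell-1)$ and $\Lambda_+^{\le\kappa}=\{\alpha\in\Lambda: 0\le\alpha_i\le \ell-1\text{ for all }i\}$. **The $n$-rank Taft algebra.** $\bar{\mathscr A}_q(n)$ is the $k$-algebra generated by $K(\epsilon_i)^{\pm1},x_i$ ($1\le i\le n$) with relations: the $K(\epsilon_i)$ commute and are invertible; $K(\epsilon_i)^\ell=1$; $K(\epsilon_i)x_jK(\epsilon_i)^{-1}=\theta(\epsilon_i,\epsilon_j)q^{\delta_{ij}}x_j$; $x_ix_j=\theta(\epsilon_i,\epsilon_j)x_jx_i$; $x_i^\ell=0$. Write $K(\alpha)=\prod_iK(\epsilon_i)^{\alpha_i}$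 and $x^\gamma=x_1^{\gamma_1}\cdots x_n^{\gamma_n}$. It is a Hopf algebra with $\Delta(K(\epsilon_i)^{\pm1})=K(\epsilon_i)^{\pm1}\otimes K(\epsilon_i)^{\pm1}$, $\Delta(x_i)=x_i\otimes1+K(\epsilon_i)\otimes x_i$, $\varepsilon(K(\epsilon_i)^{\pm1})=1$, $\varepsilon(x_i)=0$, $s(K(\epsilon_i)^{\pm1})=K(\epsilon_i)^{\mp1}$, $s(x_i)=-K(\epsilon_i)^{-1}x_i$, and $k$-basis $\{x^\gamma K(\alpha):\alpha,\gamma\in\Lambda_+^{\le\kappa}\}$. For $\alpha\in\Lambda$, $\mathcal K(\alpha)\in\bar{\mathscr A}_q(n)^*$ is the group-like element with $\mathcal K(\alpha)(x^\gamma K(\beta))=\delta_{\gamma,0}q^{\langle\alpha,\beta\rangle}$. **Drinfel'd double.** For a finite-dimensional Hopf algebra $H$ with antipode $s$, $D(H)=(H^* )^{\mathrm{cop}}\bowtie H$ is $H^*\otimes H$ with multiplication $(p\otimes h)(p'\otimes h')=p\big(h_{(1)}\rightharpoonup p'\leftharpoonup s^{-1}(h_{(3)})\big)\otimes h_{(2)}h'$, where $h\rightharpoonup p=p_{(2)}(h)p_{(1)}$, $p\leftharpoonup h=p_{(1)}(h)p_{(2)}$, and the coalgebra structure of $(H^* )^{\mathrm{cop}}\otimes H$. A Yetter–Drinfel'd $H$-module is a left $H$-module and right $H$-comodule $M$ with $h_{(1)}\cdot m_{(0)}\otimes h_{(2)}m_{(1)}=(h_{(2)}\cdot m)_{(0)}\otimes(h_{(2)}\cdot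 m)_{(1)}h_{(1)}$. It is a left $D(H)$-module via $(p\otimes h)\cdot m=p\cdot(h\cdot m)$ with $p\cdot m=p(m_{(1)})m_{(0)}$, and all left $D(H)$-modules arise this way. **The modules $H_{\chi,g}$.** For group-like $\chi\in H^*$ and $g\in H$, let $H_\chi$ be the Yetter–Drinfel'd module with underlying space $H$, coaction $\Delta$, and action $h\bullet_\chi a=(h_{(2)}\leftharpoonup\chi)\,a\,s^{-1}(h_{(1)})$, where $h\leftharpoonup\chi=\chi(h_{(1)})h_{(2)}$. Then $H_{\chi,g}:=H\bullet_\chi g\subseteq H_\chi$, a simple Yetter–Drinfel'd submodule for $H=\bar{\mathscr A}_q(n)$. *)

(* Defs.v *)
From HB Require Import structures.
From mathcomp Require Import all_boot all_order all_algebra all_field.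

Set Implicit Arguments.
Unset Strict Implicit.
Unset Printing Implicit Defensive.

Import Order.TTheory GRing.Theory Num.Theory.
Local Open Scope ring_scope.

(* The tensor product of two finite-dimensional spaces is modelled by the     *)
(* matrices of coefficients on the products of their canonical basis vectors. *)
Section Tensor.
Variable k : fieldType.

Definition tensor (U V : vectType k) : Type := 'M[k]_(\dim {:U}, \dim {:V}).

HB.instance Definition _ (U V : vectType k) :=
  Vector.copy (tensor U V) 'M[k]_(\dim {:U}, \dim {:V}).

Definition tens (U V : vectType k) (u : U) (v : V) : tensor U V :=
  \matrix_(i, j) (coord (vbasis {:U}) i u * coord (vbasis {:V}) j v).

(* For bilinear f this is the linear map with tlift f (tens u v) = f u v.     *)
Definition tlift (U V : vectType k) (W : lmodType k) (f : U -> V -> W)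
    (t : tensor U V) : W :=
  \sum_i \sum_j t i j *: f (vbasis {:U})`_i (vbasis {:V})`_j.

Lemma tlift_is_linear (U V : vectType k) (W : lmodType k) (f : U -> V -> W) :
  linear (tlift f).
Proof.
move=> a t t'; rewrite /tlift scaler_sumr -big_split; apply: eq_bigr => i _ /=.
rewrite scaler_sumr -big_split; apply: eq_bigr => j _ /=.
by rewrite !mxE scalerDl scalerA.
Qed.

Lemma tlift_tens (U V : vectType k) (W : lmodType k) (f : U -> V -> W) :
  (forall v, linear (f^~ v)) -> (forall u, linear (f u)) ->
  forall u v, tlift f (tens u v) = f u v.
Proof.
move=> f_l f_r u v.
pose Fl v : {linear U -> W} :=
  HB.pack (f^~ v) (GRing.isLinear.Build k U W _ (f^~ v) (f_l v)).
pose Fr u : {linear V -> W} :=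
  HB.pack (f u) (GRing.isLinear.Build k V W _ (f u) (f_r u)).
rewrite [in RHS](coord_vbasis (memvf u)) -[RHS]/(Fl v _) linear_sum.
apply: eq_bigr => i _; rewrite linearZ /=.
rewrite [in RHS](coord_vbasis (memvf v)) -[f _ (\sum_(j < _) _)]/(Fr _ _).
rewrite linear_sum scaler_sumr; apply: eq_bigr => j _.
by rewrite linearZ /= scalerA mxE.
Qed.

End Tensor.

Definition dual (k : fieldType) (H : vectType k) : vectType k := 'Hom(H, k^o).

Section Hopf.
Variables (k : fieldType) (H : falgType k).

Definition tmul (t t' : tensor H H) : tensor H H :=
  tlift (fun a b => tlift (fun a' b' => tens (a * a') (b * b')) t') t.

Record hopf_algebra := HopfAlgebra {
  cop : 'Hom(H, tensor H H);
  counit : 'Hom(H, k^o);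
  antip : 'End(H);
  cop_coassoc : forall h,
    tlift (fun a b => tlift (fun a1 a2 => tens a1 (tens a2 b)) (cop a)) (cop h)
    = tlift (fun a b => tens a (cop b)) (cop h);
  cop_counitl : forall h, tlift (fun a b => counit a *: b) (cop h) = h;
  cop_counitr : forall h, tlift (fun a b => counit b *: a) (cop h) = h;
  cop1 : cop 1 = tens 1 1;
  copM : forall g h, cop (g * h) = tmul (cop g) (cop h);
  counit1 : counit 1 = 1;
  counitM : forall g h, counit (g * h) = counit g * counit h;
  antipl : forall h, tlift (fun a b => antip a * b) (cop h) = (counit h)%:A;
  antipr : forall h, tlift (fun a b => a * antip b) (cop h) = (counit h)%:A }.

Variable S : hopf_algebra.

(* sweedler2 f h = f h_(1) h_(2) and sweedler3 f h = f h_(1) h_(2) h_(3)      *)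
Definition sweedler2 (W : lmodType k) (f : H -> H -> W) (h : H) : W :=
  tlift f (cop S h).
Definition sweedler3 (W : lmodType k) (f : H -> H -> H -> W) (h : H) : W :=
  sweedler2 (fun a c => sweedler2 (fun b1 b2 => f b1 b2 c) a) h.

(* The antipode of a finite-dimensional Hopf algebra is bijective, so that    *)
(* _^-1%VF is its inverse map.                                                *)
Definition sinv : H -> H := (antip S)^-1%VF.

Definition conv (p p' : dual H) : dual H :=
  linfun (fun h => sweedler2 (fun a b => (p a : k^o) * (p' b : k)) h).

(* h -> p = p_(2)(h) p_(1) and p <- h = p_(1)(h) p_(2), for the coproduct of  *)
(* the dual given by p_(1)(a) p_(2)(b) = p (a * b).                           *)
Definition hitl (h : H) (p : dual H) : dual H := linfun (fun a => p (a * h)).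
Definition hitr (p : dual H) (h : H) : dual H := linfun (fun a => p (h * a)).

Definition drinfeld : vectType k := tensor (dual H) H.

Definition dd1 : drinfeld := tens (counit S : dual H) (1 : H).

Definition ddmul (t t' : drinfeld) : drinfeld :=
  tlift (fun (p : dual H) (h : H) =>
    tlift (fun (p' : dual H) (h' : H) =>
      sweedler3 (fun h1 h2 h3 =>
        tens (conv p (hitr (hitl h1 p') (sinv h3))) (h2 * h') : drinfeld) h)
    t') t.

Record dd_module (V : lmodType k) (act : drinfeld -> V -> V) : Prop :=
  DDModule {
    dd_actl : forall v, linear (act^~ v);
    dd_actr : forall d, linear (act d);
    dd_act1 : forall v, act dd1 v = v;
    dd_actM : forall d d' v, act (ddmul d d') v = act d (act d' v) }.

Definition dd_simple (V : lmodType k) (act : drinfeld -> V -> V) : Prop :=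
  (exists v : V, v != 0) /\
  forall W : V -> Prop,
    W 0 -> (forall a u v, W u -> W v -> W (a *: u + v)) ->
    (forall d v, W v -> W (act d v)) ->
    (forall v, W v -> v = 0) \/ (forall v, W v).

(* (p (x) h) . m = p ((h . m)_(1)) (h . m)_(0)                                *)
Definition yd_dact (M : vectType k) (act : H -> M -> M)
    (coact : M -> tensor M H) (d : drinfeld) (m : M) : M :=
  tlift (fun (p : dual H) (h : H) =>
    tlift (fun m0 m1 => (p m1 : k) *: m0) (coact (act h m))) d.

(* h <- chi = chi(h_(1)) h_(2)                                                *)
Definition twistr (h : H) (chi : dual H) : H :=
  sweedler2 (fun h1 h2 => (chi h1 : k) *: h2) h.

Definition bullet (chi : dual H) (h a : H) : H :=
  sweedler2 (fun h1 h2 => twistr h2 chi * a * sinv h1) h.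

Definition Hchi_dact (chi : dual H) : drinfeld -> H -> H :=
  yd_dact (bullet chi) (cop S).

Definition Hchig (chi : dual H) (g : H) : {vspace H} :=
  limg (linfun (fun h => bullet chi h g)).

Definition dd_iso_Hchig (V : lmodType k) (act : drinfeld -> V -> V)
    (chi : dual H) (g : H) : Prop :=
  exists f : {linear V -> subvs_of (Hchig chi g)},
    bijective f /\
    forall d v, vsval (f (act d v)) = Hchi_dact chi d (vsval (f v)).

End Hopf.

Section Taft.
Variables (k : fieldType) (n l : nat) (q : k).

Definition lattice := 'rV[int]_n.
Definition eps (i : 'I_n) : lattice := delta_mx 0 i.

Definition lstar (a b : lattice) : int :=
  \sum_(j < n) \sum_(i < n | (j < i)%N) a 0 i * b 0 j.
Definition theta (a b : lattice) : k := q ^ (lstar a b - lstar b a).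
Definition pairing (a b : lattice) : int := \sum_(i < n) a 0 i * b 0 i.

(* The box 0 <= a_i <= l - 1 in the lattice.                                  *)
Definition box := 'rV['I_l]_n.
Definition box_val (a : box) : lattice := map_mx (fun i : 'I_l => (i : nat)%:Z) a.

(* K' i is the generator K(eps_i)^-1.                                         *)
Record taft_relations (B : algType k) (K K' x : 'I_n -> B) : Prop :=
  TaftRelations {
    taftKC : forall i j, K i * K j = K j * K i;
    taftKV : forall i, K i * K' i = 1;
    taftVK : forall i, K' i * K i = 1;
    taftKl : forall i, K i ^+ l = 1;
    taftKx : forall i j,
      K i * x j * K' i = (theta (eps i) (eps j) * q ^+ (i == j)) *: x j;
    taftxx : forall i j, x i * x j = theta (eps i) (eps j) *: (x j * x i);
    taftxl : forall i, x i ^+ l = 0 }.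

(* "Generated by K, K', x with these relations" is the universal property.    *)
Record taft_presented (A : algType k) (K K' x : 'I_n -> A) : Prop :=
  TaftPresented {
    taft_rel : taft_relations K K' x;
    taft_lift : forall (B : algType k) (L L' y : 'I_n -> B),
      taft_relations L L' y ->
      exists f : {lrmorphism A -> B},
        [/\ forall i, f (K i) = L i, forall i, f (K' i) = L' i
          & forall i, f (x i) = y i];
    taft_uniq : forall (B : algType k) (f g : {lrmorphism A -> B}),
      (forall i, f (K i) = g (K i)) -> (forall i, f (K' i) = g (K' i)) ->
      (forall i, f (x i) = g (x i)) -> f =1 g }.

Variable A : falgType k.

Record taft_hopf (S : hopf_algebra A) (K K' x : 'I_n -> A) : Prop :=
  TaftHopf {
    taft_pres : taft_presented K K' x;
    taft_copK : forall i, cop S (K i) = tens (K i) (K i);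
    taft_copV : forall i, cop S (K' i) = tens (K' i) (K' i);
    taft_copx : forall i, cop S (x i) = tens (x i) 1 + tens (K i) (x i);
    taft_counitK : forall i, counit S (K i) = 1;
    taft_counitV : forall i, counit S (K' i) = 1;
    taft_counitx : forall i, counit S (x i) = 0;
    taft_antipK : forall i, antip S (K i) = K' i;
    taft_antipV : forall i, antip S (K' i) = K i;
    taft_antipx : forall i, antip S (x i) = - (K' i * x i) }.

Variables K x : 'I_n -> A.

Definition Kmon (a : lattice) : A := \prod_(i < n) K i ^ a 0 i.
Definition xmon (c : box) : A := \prod_(i < n) x i ^+ c 0 i.

Definition taft_basis : #|{: box * box}|.-tuple A :=
  [tuple xmon (enum_val m).1 * Kmon (box_val (enum_val m).2)
     | m < #|{: box * box}|].

(* The linear form with value delta_(c,0) q^<a,b> at x^c K(b), for c and b in *)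
(* the box.                                                                   *)
Definition Kdual (a : lattice) : dual A :=
  linfun (fun h => \sum_m (coord taft_basis m h : k^o) *
    (if box_val (enum_val m).1 == 0
     then q ^ pairing a (box_val (enum_val m).2) else 0)).

End Taft.

(* Main.v *)
From HB Require Import structures.
Require Import Defs.
From mathcomp Require Import all_boot all_order all_algebra all_field.
From Stdlib Require Import Classical.
Set Implicit Arguments.
Unset Strict Implicit.
Unset Printing Implicit Defensive.
Import GRing.Theory.
Local Open Scope ring_scope.

(* A simple module V over the double is a quotient of the double, hence has   *)
(* a nonzero linear form. Since the x_i are nilpotent and skew-commute, and   *)
(* the K_i commute and have order l, some nonzero form f satisfies            *)
(* f (x_i v) = 0 and f (K_i v) = q^a_i f v, that is f (h v) = chi(h) f v with *)
(* chi = K(a) in the dual. As H_chi is coinduced, v |-> f(v_(0)) v_(1) is a   *)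
(* morphism of Yetter-Drinfel'd modules F : V -> H_chi, injective because V   *)
(* is simple. Its image is a nonzero right coideal of H, so it contains a     *)
(* group-like element g = K(b), as one sees on the filtration of H by degree  *)
(* in the x_i. If F v0 = g, the commutation rules of the double show that     *)
(* H v0 is a submodule, hence V = H v0 and F(V) = H . g = H_(chi,g).          *)

(** * Linear maps on tensors and Sweedler notation *)

(** The double acts through [A] and its dual. By a Frobenius reciprocity, a linear form f on [V]
    with f (h v) = chi(h) f v is the same as a morphism of modules over the double from [V] to
    H_chi; so the task is to find such a form and to identify the image. [exists_nonzero_form] finds
    some form, as [V] is cyclic over a finite-dimensional algebra, and [weight_form] turns it into a
    common eigenvector of the [K i] that the nilpotent [x i] annihilate. The resulting map
    [coeff_map] is a morphism by [coeff_map_act] and injective by [coeff_map_inj].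

    Its image is a right coideal. Forms that vanish on the group algebra of the [K i] lower the
    degree in the [x i], so the image meets that group algebra, and splitting a common vector into
    components yields a group-like g ([coideal_grouplike]). If v0 is sent to g, the dual only
    rescales v0; moving the dual past [A] gives V = A v0 ([alg_act_generates]), and the image is the
    orbit of g.

    Two facts about [A] support this. It is known only by its presentation, so [taft_free] proves
    its monomials independent by letting them act on a matrix model; this makes [Kdual] a character
    ([Kdual_char]). And [antip_surj] makes [sinv] a true inverse, so that [ddmul_K] and [ddmul_x]
    give explicit commutation rules in the double. *)

Section LinearAlgebra.
Variable k : fieldType.

Lemma linear0f (U V : lmodType k) (f : U -> V) : linear f -> f 0 = 0.
Proof.
move=> f_lin; have := f_lin (-1) 0 0.
by rewrite scaler0 addr0 scaleN1r addNr.
Qed.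

Lemma linearZf (U V : lmodType k) (f : U -> V) :
  linear f -> forall a u, f (a *: u) = a *: f u.
Proof. by move=> f_lin a u; rewrite -[a *: u]addr0 f_lin linear0f // addr0. Qed.

Lemma linearDf (U V : lmodType k) (f : U -> V) :
  linear f -> forall u v, f (u + v) = f u + f v.
Proof. by move=> f_lin u v; rewrite -{1}[u]scale1r f_lin scale1r. Qed.

Lemma linearNf (U V : lmodType k) (f : U -> V) :
  linear f -> forall u, f (- u) = - f u.
Proof. by move=> f_lin u; rewrite -scaleN1r linearZf // scaleN1r. Qed.

Lemma linear_sumf (U V : lmodType k) (f : U -> V) : linear f ->
  forall (I : Type) (r : seq I) (P : pred I) (F : I -> U),
  f (\sum_(i <- r | P i) F i) = \sum_(i <- r | P i) f (F i).
Proof.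
move=> f_lin I r P F.
by rewrite (big_morph f (linearDf f_lin) (linear0f f_lin)).
Qed.

Lemma linfunP (U V : vectType k) (f : U -> V) : linear f -> linfun f =1 f.
Proof.
move=> f_lin u.
pose F : {linear U -> V} := HB.pack f (GRing.isLinear.Build k U V _ f f_lin).
exact: (lfunE F u).
Qed.

(** Subtracting the projection onto [N] kills [N] but not [u], and some coordinate of what remains
    of [u] is nonzero. *)
Lemma exists_form (U : vectType k) (N : {vspace U}) (u : U) : u \notin N ->
  exists2 p : dual U, (forall w, w \in N -> p w = 0) & p u != 0.
Proof.
move=> uN; pose P w := w - projv N w.
have P_lin : linear P by move=> a v w; rewrite /P linearP opprD addrACA scalerBr.
have Pu : P u != 0.
  by rewrite subr_eq0; apply: contra uN => /eqP ->; apply: memv_proj.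
have [i Pui] : exists i, coord (vbasis {:U}) i (P u) != 0.
  apply/existsP; apply: contraNT Pu; rewrite negb_exists => /forallP Pu0.
  rewrite (coord_vbasis (memvf (P u))) big1 // => i _.
  by move/negPn/eqP: (Pu0 i) => ->; rewrite scale0r.
have p_lin : linear (fun w => coord (vbasis {:U}) i (P w) : k^o).
  by move=> a v w; rewrite P_lin linearP.
exists (linfun (fun w => coord (vbasis {:U}) i (P w) : k^o)) => [w wN|].
  by rewrite linfunP // /P projv_id // subrr linear0.
by rewrite linfunP.
Qed.

Lemma dual_ext (U : vectType k) (u v : U) :
  (forall p : dual U, p u = p v) -> u = v.
Proof.
move=> eq_uv; apply/eqP; rewrite -subr_eq0 -memv0; apply: contraT => /exists_form.
by case=> p _; rewrite linearB /= eq_uv subrr eqxx.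
Qed.

Lemma dualP (U : vectType k) (p p' : dual U) : p =1 p' -> p = p'.
Proof. by move=> eq_p; apply/lfunP. Qed.

Lemma span_ind (U : vectType k) (X : seq U) (P : U -> Prop) : P 0 ->
  (forall a u v, P u -> P v -> P (a *: u + v)) -> (forall u, u \in X -> P u) ->
  forall u, u \in <<X>>%VS -> P u.
Proof.
move=> P0 P_lin PX u /(@coord_span _ _ _ (in_tuple X)) ->.
apply: big_ind => // [v w Pv Pw|i _].
  by rewrite -[v]scale1r; apply: P_lin.
by rewrite -[_ *: _]addr0; apply: P_lin => //; apply: PX; apply: mem_nth.
Qed.

Definition bilinear_fun (U V W : lmodType k) (f : U -> V -> W) : Prop :=
  (forall v, linear (f^~ v)) /\ (forall u, linear (f u)).

Lemma tensPl (U V : vectType k) (v : V) : linear (fun u : U => tens u v).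
Proof.
move=> a u u'; apply/matrixP => i j.
by rewrite !mxE linearP mulrDl mulrA.
Qed.

Lemma tensPr (U V : vectType k) (u : U) : linear (fun v : V => tens u v).
Proof.
move=> a v v'; apply/matrixP => i j.
by rewrite !mxE linearP mulrDr mulrCA.
Qed.

Lemma tlift_lin (U V : vectType k) (W : lmodType k) (f g : U -> V -> W) a t :
  tlift (fun u v => a *: f u v + g u v) t = a *: tlift f t + tlift g t.
Proof.
rewrite /tlift scaler_sumr -big_split; apply: eq_bigr => i _ /=.
rewrite scaler_sumr -big_split; apply: eq_bigr => j _ /=.
by rewrite scalerDr !scalerA mulrC.
Qed.

Lemma eq_tlift (U V : vectType k) (W : lmodType k) (f g : U -> V -> W) :
  (forall u v, f u v = g u v) -> tlift f =1 tlift g.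
Proof.
by move=> eq_fg t; apply: eq_bigr => i _; apply: eq_bigr => j _; rewrite eq_fg.
Qed.

Lemma tlift_comp (U V : vectType k) (W X : lmodType k) (f : U -> V -> W)
  (L : W -> X) t : linear L -> L (tlift f t) = tlift (fun u v => L (f u v)) t.
Proof.
move=> L_lin; rewrite /tlift linear_sumf //; apply: eq_bigr => i _.
by rewrite linear_sumf //; apply: eq_bigr => j _; rewrite linearZf.
Qed.

Lemma tlift_tens_id (U V : vectType k) (t : tensor U V) :
  t = tlift (@tens k U V) t.
Proof.
apply/matrixP => i j; rewrite /tlift summxE (bigD1 i) //= summxE (bigD1 j) //=.
rewrite !mxE !coord_free ?(basis_free (vbasisP _)) // !eqxx !mulr1.
rewrite !big1 ?addr0 // => [i' ne_i | j' ne_j].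
  rewrite summxE big1 // => j' _; rewrite !mxE.
  by rewrite !coord_free ?(basis_free (vbasisP _)) // (negPf ne_i) mul0r mulr0.
rewrite !mxE !coord_free ?(basis_free (vbasisP _)) //.
by rewrite (negPf ne_j) !mulr0.
Qed.

(** Reduces linear statements about the double to pure tensors. *)
Lemma tensor_ind (U V : vectType k) (P : tensor U V -> Prop) : P 0 ->
  (forall a t t', P t -> P t' -> P (a *: t + t')) ->
  (forall u v, P (tens u v)) -> forall t, P t.
Proof.
move=> P0 P_lin Pt t; rewrite (tlift_tens_id t).
have PD u v : P u -> P v -> P (u + v).
  by move=> Pu Pv; rewrite -[u]scale1r; apply: P_lin.
apply: big_ind => // i _; apply: big_ind => // j _.
by rewrite -[_ *: _]addr0; apply: P_lin.
Qed.

(* The kernel of a linear map out of a finite-dimensional space is found as a *)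
(* maximal subspace on which the map vanishes.                                *)
Lemma kernel_vspace (U : vectType k) (V : lmodType k) (phi : U -> V) :
  linear phi -> exists N : {vspace U}, forall u, u \in N <-> phi u = 0.
Proof.
move=> phi_lin.
suff IH m (N : {vspace U}) : (\dim {:U} <= m + \dim N)%N ->
    (forall u, u \in N -> phi u = 0) ->
    exists N : {vspace U}, forall u, u \in N <-> phi u = 0.
  apply: (IH (\dim {:U}) 0%VS); first exact: leq_addr.
  by move=> u; rewrite memv0 => /eqP ->; apply: linear0f.
elim: m N => [|m IHm] N dimN phiN.
  have NT : N = fullv by apply/eqP; rewrite eqEdim subvf.
  by exists N => u; split=> [/phiN // | _]; rewrite NT memvf.
have [[u [phiu uN]]|no_u] := classic (exists u, phi u = 0 /\ u \notin N).
  apply: (IHm (N + <[u]>)%VS).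
    rewrite (leq_trans dimN) // addSnnS leq_add2l ltn_neqAle dimvS ?addvSl // andbT.
    apply: contra uN => dimE; rewrite (_ : N = (N + <[u]>)%VS).
      by rewrite memvE addvSr.
    by apply/eqP; rewrite eqEdim addvSl (eqP dimE) /=.
  move=> w /memv_addP[w1 /phiN phiw1 [w2 /vlineP[c ->] ->]].
  by rewrite linearDf // phiw1 linearZf // phiu scaler0 addr0.
exists N => u; split=> [/phiN // | phiu].
by apply: contraT => uN; case: no_u; exists u.
Qed.

End LinearAlgebra.

Section HopfAlgebra.
Variables (k : fieldType) (H : falgType k) (S : hopf_algebra H).
Implicit Types (a b c g h : H) (p r : dual H).

Lemma sweedler_lin (W : lmodType k) (f : H -> H -> W) : linear (sweedler2 S f).
Proof. by move=> a u v; rewrite /sweedler2 linearP tlift_is_linear. Qed.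

Lemma eq_sweedler (W : lmodType k) (f g : H -> H -> W) :
  (forall a b, f a b = g a b) -> sweedler2 S f =1 sweedler2 S g.
Proof. by move=> eq_fg h; apply: eq_tlift. Qed.

Lemma sweedler_comb (W : lmodType k) (f g : H -> H -> W) (a : k) h :
  sweedler2 S (fun u v => a *: f u v + g u v) h =
  a *: sweedler2 S f h + sweedler2 S g h.
Proof. exact: tlift_lin. Qed.

Lemma sweedlerD (W : lmodType k) (f g : H -> H -> W) h :
  sweedler2 S (fun u v => f u v + g u v) h = sweedler2 S f h + sweedler2 S g h.
Proof.
rewrite -[sweedler2 S f h]scale1r -sweedler_comb; apply: eq_sweedler => u v.
by rewrite scale1r.
Qed.

Lemma sweedler_comp (W X : lmodType k) (f : H -> H -> W) (L : W -> X) h :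
  linear L -> L (sweedler2 S f h) = sweedler2 S (fun u v => L (f u v)) h.
Proof. exact: tlift_comp. Qed.

Lemma sweedler_tens (W : lmodType k) (f : H -> H -> W) h a b :
  bilinear_fun f -> cop S h = tens a b -> sweedler2 S f h = f a b.
Proof. by case=> f_l f_r; rewrite /sweedler2 => ->; apply: tlift_tens. Qed.

Lemma sweedlerM (W : lmodType k) (f : H -> H -> W) g h : bilinear_fun f ->
  sweedler2 S f (g * h) =
  sweedler2 S (fun a b => sweedler2 S (fun a' b' => f (a * a') (b * b')) h) g.
Proof.
case=> f_l f_r; rewrite /sweedler2 copM /tmul.
rewrite (tlift_comp _ _ (tlift_is_linear f)); apply: eq_tlift => a b.
rewrite (tlift_comp _ _ (tlift_is_linear f)); apply: eq_tlift => a' b'.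
exact: tlift_tens.
Qed.

(** Coassociativity: [sweedler3] splits the first factor of the coproduct again, and trilinearity
    allows splitting the second one instead. *)
Lemma sweedlerA (W : lmodType k) (f : H -> H -> H -> W) h :
  (forall b c, linear (fun a => f a b c)) ->
  (forall a c, linear (fun b => f a b c)) ->
  (forall a b, linear (f a b)) ->
  sweedler3 S f h = sweedler2 S (fun a c => sweedler2 S (f a) c) h.
Proof.
move=> f1 f2 f3; rewrite /sweedler3 /sweedler2.
pose F a t := tlift (f a) t.
have F_r a : linear (F a) by exact: tlift_is_linear.
have F_l t : linear (F^~ t).
  by move=> c u v; rewrite /F -tlift_lin; apply: eq_tlift => b d; rewrite f1.
have FE a b c : F a (tens b c) = f a b c by exact: tlift_tens.
have tF := tlift_is_linear F.
transitivity (tlift F (tlift (fun a b => tens a (cop S b)) (cop S h))).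
  rewrite -cop_coassoc tlift_comp //; apply: eq_tlift => a c.
  rewrite tlift_comp //; apply: eq_tlift => b b'.
  by rewrite tlift_tens ?FE.
rewrite tlift_comp //; apply: eq_tlift => a c.
by rewrite tlift_tens.
Qed.

Lemma convE p r h : conv S p r h = sweedler2 S (fun a b => (p a : k^o) * (r b : k)) h.
Proof. by rewrite linfunP //; apply: sweedler_lin. Qed.

Lemma hitlE h p a : hitl h p a = p (a * h).
Proof. by rewrite linfunP // => c u v; rewrite mulrDl -scalerAl linearP. Qed.

Lemma hitrE h p a : hitr p h a = p (h * a).
Proof. by rewrite linfunP // => c u v; rewrite mulrDr -scalerAr linearP. Qed.

Lemma conv_counitr p : conv S p (counit S) = p.
Proof.
apply: dualP => h; rewrite convE -[in RHS](cop_counitr S h).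
rewrite (tlift_comp _ _ (linearP p)); apply: eq_tlift => a b.
by rewrite linearZ /= mulrC.
Qed.

Lemma conv_counitl p : conv S (counit S) p = p.
Proof.
apply: dualP => h; rewrite convE -[in RHS](cop_counitl S h).
rewrite (tlift_comp _ _ (linearP p)); apply: eq_tlift => a b.
by rewrite linearZ.
Qed.

End HopfAlgebra.

(** * The monomial basis *)

Section SkewCommutation.
Variables (k : fieldType) (A : falgType k).
Implicit Types a b : A.

(** The scalar is left unspecified: for spanning arguments it only matters that reordering a
    monomial rescales it. *)
Definition skew_comm a b := exists s : k, a * b = s *: (b * a).

Lemma skew_commM a b b' :
  skew_comm a b -> skew_comm a b' -> skew_comm a (b * b').
Proof.
case=> s ab [s' ab']; exists (s * s').
by rewrite mulrA ab -scalerAl -!mulrA ab' -scalerAr scalerA.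
Qed.

Lemma skew_comm1 a : skew_comm a 1.
Proof. by exists 1; rewrite mulr1 mul1r scale1r. Qed.

Lemma skew_commX a b m : skew_comm a b -> skew_comm a (b ^+ m).
Proof.
move=> ab; elim: m => [|m IHm]; first exact: skew_comm1.
by rewrite exprS; apply: skew_commM.
Qed.

Lemma skew_comm_prod a (I : Type) (r : seq I) (F : I -> A) :
  (forall i, skew_comm a (F i)) -> skew_comm a (\prod_(i <- r) F i).
Proof.
move=> aF; apply: (big_ind (skew_comm a)) => //; first exact: skew_comm1.
exact: skew_commM.
Qed.

(** The new factor is moved to the right, past the powers of the other generators, until it merges
    with its own power. *)
Lemma skew_prod_insert (I : eqType) (y : I -> A) (c : I -> nat) (r : seq I) i :
  (forall i j, skew_comm (y i) (y j)) -> uniq r -> i \in r ->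
  exists s : k, y i * \prod_(j <- r) y j ^+ c j =
    s *: \prod_(j <- r) y j ^+ (c j + (j == i)).
Proof.
move=> yy; elim: r => // j r IHr /= /andP[jr Ur]; rewrite inE !big_cons.
have [-> _ | ne_ij /= ir] := eqVneq i j.
  exists 1; rewrite scale1r addn1 mulrA -exprS; congr (_ * _).
  rewrite big_seq [RHS]big_seq; apply: eq_bigr => j' j'r.
  by case: (eqVneq j' j) jr => [<- | _ _]; rewrite ?j'r ?addn0.
have [s ys] := skew_commX (c j) (yy i j); have [s' ys'] := IHr Ur ir.
exists (s * s'); rewrite mulrA ys -scalerAl -mulrA ys' -scalerAr scalerA.
by rewrite addn0.
Qed.

Lemma prod_pow_ind (I : Type) (y : I -> A) (c : I -> nat) (P : A -> Prop)
    (r : seq I) w : (forall i b, P b -> P (y i * b)) -> P w ->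
  P ((\prod_(i <- r) y i ^+ c i) * w).
Proof.
move=> Py Pw; elim: r => [|i r IHr]; rewrite ?big_nil ?mul1r //.
rewrite big_cons -mulrA; elim: (c i) => [|m IHm]; rewrite ?mul1r //.
by rewrite exprS -mulrA; apply: Py.
Qed.

Lemma prod_eq0 (I : eqType) (r : seq I) (F : I -> A) i :
  i \in r -> F i = 0 -> \prod_(j <- r) F j = 0.
Proof.
move=> ir Fi; elim: r ir => // j r IHr; rewrite inE big_cons.
by case/predU1P=> [<- | /IHr ->]; rewrite ?Fi ?mul0r ?mulr0.
Qed.

End SkewCommutation.

(** * Spanning by ordered monomials *)

Section TaftBasis.
Variables (k : fieldType) (n l : nat) (q : k) (q_prim : l.-primitive_root q).
Variables (A : falgType k) (K K' x : 'I_n -> A).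
Hypothesis A_pres : taft_presented l q K K' x.

Let rels := taft_rel A_pres.

Lemma prim_gt0 : (0 < l)%N. Proof. exact: prim_order_gt0 q_prim. Qed.

Lemma prim_neq0 : q != 0.
Proof.
apply/eqP => q0; have := prim_expr_order q_prim.
by move/eqP; rewrite q0 expr0n gtn_eqF ?prim_gt0 //= eq_sym oner_eq0.
Qed.

Lemma theta_neq0 (a b : lattice n) : theta q a b != 0.
Proof. exact/expfz_neq0/prim_neq0. Qed.

Lemma K'E i : K' i = K i ^+ l.-1.
Proof.
rewrite -[LHS]mul1r -(taftKl rels i) -[in X in X * _](prednK prim_gt0) exprSr -mulrA.
by rewrite (taftKV rels) mulr1.
Qed.

Lemma KK'K i : K i * K' i = 1. Proof. exact: taftKV rels i. Qed.
Lemma K'K i : K' i * K i = 1. Proof. exact: taftVK rels i. Qed.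

Lemma Kx i j :
  K i * x j = (theta q (eps i) (eps j) * q ^+ (i == j)) *: (x j * K i).
Proof. by rewrite scalerAl -(taftKx rels) -!mulrA K'K mulr1. Qed.

Lemma skew_xx i j : skew_comm (x i) (x j).
Proof. by exists (theta q (eps i) (eps j)); apply: taftxx rels i j. Qed.

Lemma skew_KK i j : skew_comm (K i) (K j).
Proof. by exists 1; rewrite scale1r; apply: taftKC rels i j. Qed.

Lemma skew_Kx i j : skew_comm (K i) (x j).
Proof. by eexists; apply: Kx. Qed.

(* The subalgebra C generated by K, K' and x satisfies the relations, and the *)
(* composite A -> C -> A is the identity by the uniqueness clause.            *)
Lemma taft_gen (W : {vspace A}) : 1 \in W ->
  (forall i w, w \in W -> K i * w \in W) ->
  (forall i w, w \in W -> x i * w \in W) -> forall a, a \in W.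
Proof.
move=> W1 WK Wx a.
pose gs := codom K ++ codom K' ++ codom x.
pose C := <<<<gs>>>>%AS.
have CK i : K i \in C.
  by apply/(subvP (sub_agenv _))/memv_span; rewrite mem_cat codom_f.
have CK' i : K' i \in C.
  by apply/(subvP (sub_agenv _))/memv_span; rewrite !mem_cat codom_f orbT.
have Cx i : x i \in C.
  by apply/(subvP (sub_agenv _))/memv_span; rewrite !mem_cat codom_f !orbT.
have C1 : algid C = 1.
  by apply/eqP; rewrite algid_eq1; apply/(subvP (sub1_agenv _))/memv_line.
have val1 : vsval (1 : subvs_of C) = 1 by exact: C1.
have valX (u : subvs_of C) m : vsval (u ^+ m) = vsval u ^+ m.
  by elim: m => [|m IHm]; rewrite ?expr0 // !exprS -IHm.
pose L i := Subvs (CK i); pose L' i := Subvs (CK' i); pose y i := Subvs (Cx i).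
have relC : taft_relations l q L L' y.
  split=> [i j|i|i|i|i j|i j|i]; apply/val_inj.
  - exact: taftKC rels i j.
  - by rewrite /= C1; apply: taftKV rels i.
  - by rewrite /= C1; apply: taftVK rels i.
  - by apply: (etrans (valX _ _)); rewrite (taftKl rels) -C1.
  - exact: taftKx rels i j.
  - exact: taftxx rels i j.
  - by apply: (etrans (valX _ _)); apply: taftxl rels i.
have [f [fK fK' fx]] := taft_lift A_pres relC.
pose g b : A := vsval (f b).
have g_lin : linear g by move=> c u v; rewrite /g !linearP.
have g_mul : monoid_morphism g.
  by split=> [|u v]; rewrite /g ?rmorph1 ?rmorphM.
pose G : {lrmorphism A -> A} := HB.pack g (GRing.isLinear.Build k A A _ g g_lin)
  (GRing.isMonoidMorphism.Build A A g g_mul).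
have /(_ a) /= Ga : G =1 (idfun : {lrmorphism A -> A}).
  apply: (taft_uniq A_pres) => i.
  - by rewrite /= /g fK.
  - by rewrite /= /g fK'.
  - by rewrite /= /g fx.
(* It remains to see that [C] lies in [W], which holds because [W] contains 1 and is stable under
   left multiplication by the generators; each [K' i] is a power of [K i]. *)
suff CW : (agenv <<gs>> <= W)%VS by rewrite -Ga (subvP CW) // /g subvsP.
apply: agenv_sub_modl; first by rewrite -memvE.
apply/prodvP => b w /(@coord_span _ _ _ (in_tuple gs)) -> wW; rewrite mulr_suml.
apply: memv_suml => j _; rewrite -scalerAl memvZ //.
have : (in_tuple gs)`_j \in gs by apply: mem_nth.
rewrite !mem_cat => /or3P[]/codomP[i ->]; [exact: WK | | exact: Wx].
rewrite K'E; elim: l.-1 => [|m IHm]; first by rewrite mul1r.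
by rewrite exprS -mulrA WK.
Qed.

Let xm (c : 'I_n -> nat) := \prod_(i < n) x i ^+ c i.
Let Km (b : 'I_n -> nat) := \prod_(i < n) K i ^+ b i.

Lemma KmonE (b : box n l) : Kmon K (box_val b) = Km (fun i => b 0 i).
Proof. by apply: eq_bigr => i _; rewrite mxE. Qed.

Lemma taft_basisE (m : 'I_#|{: box n l * box n l}|) :
  (taft_basis l K x)`_m =
  xmon x (enum_val m).1 * Kmon K (box_val (enum_val m).2).
Proof. by rewrite -tnth_nth tnth_mktuple. Qed.

Lemma Km_box b : exists b' : box n l, Km b = Kmon K (box_val b').
Proof.
exists (\row_i Ordinal (ltn_pmod (b i) prim_gt0)); rewrite KmonE.
apply: eq_bigr => i _; rewrite mxE /=.
by rewrite -(expr_mod _ (taftKl rels i)).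
Qed.

Lemma K_mul_Kmon i (b : box n l) : exists (s : k) (b' : box n l),
  K i * Kmon K (box_val b) = s *: Kmon K (box_val b').
Proof.
rewrite KmonE; have [s ->] := skew_prod_insert (fun j => b 0 j : nat) skew_KK
  (index_enum_uniq _) (mem_index_enum i).
by have [b' bE] := Km_box (fun j => b 0%R j + (j == i))%N; exists s, b'; rewrite -bE.
Qed.

(** Exponents outside the box do no harm: a power of [x i] of exponent at least [l] vanishes, and
    exponents of [K i] are reduced modulo [l]. *)
Lemma mem_taft_span c b : xm c * Km b \in <<taft_basis l K x>>%VS.
Proof.
have [/forallP c_lt | /forallPn[i ci]] := boolP [forall i, (c i < l)%N]; last first.
  suff -> : xm c = 0 by rewrite mul0r mem0v.
  rewrite /xm (prod_eq0 (i := i)) ?mem_index_enum //.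
  by move: ci; rewrite -leqNgt => /subnK <-; rewrite exprD (taftxl rels) mulr0.
pose cb : box n l := \row_i Ordinal (c_lt i).
have [bb ->] := Km_box b.
suff -> : xm c * Kmon K (box_val bb) = (taft_basis l K x)`_(enum_rank (cb, bb)).
  by apply: memv_span; apply: mem_nth; rewrite size_tuple.
rewrite taft_basisE enum_rankK /=; congr (_ * _).
by apply: eq_bigr => i _; rewrite mxE.
Qed.

(** The span contains 1 and, by skew commutation, is stable under left multiplication by each [K i]
    and [x i], so [taft_gen] applies. *)
Lemma taft_span a : a \in <<taft_basis l K x>>%VS.
Proof.
apply: taft_gen => [|i w|i w].
- have := mem_taft_span (fun=> 0%N) (fun=> 0%N).
  by rewrite /xm /Km !big1 ?mulr1.
- move=> /coord_span ->; rewrite mulr_sumr; apply: memv_suml => m _.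
  rewrite -scalerAr memvZ // taft_basisE KmonE /xmon mulrA.
  have [s ->] : skew_comm (K i) (\prod_j x j ^+ ((enum_val m).1 0 j : nat)).
    by apply: skew_comm_prod => j; apply/skew_commX/skew_Kx.
  rewrite -scalerAl memvZ // -mulrA.
  have [s' ->] := skew_prod_insert (fun j => (enum_val m).2 0 j : nat) skew_KK
    (index_enum_uniq _) (mem_index_enum i).
  by rewrite -scalerAr memvZ // mem_taft_span.
- move=> /coord_span ->; rewrite mulr_sumr; apply: memv_suml => m _.
  rewrite -scalerAr memvZ // taft_basisE KmonE /xmon mulrA.
  have [s' ->] := skew_prod_insert (fun j => (enum_val m).1 0 j : nat) skew_xx
    (index_enum_uniq _) (mem_index_enum i).
  by rewrite -scalerAl memvZ // mem_taft_span.
Qed.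

(** The induction principle by which identities linear in an element of [A] are later checked one
    generator at a time, from the left. *)
Lemma taft_ind (P : A -> Prop) :
  (forall (c : k) u v, P u -> P v -> P (c *: u + v)) -> P 1 ->
  (forall i a, P a -> P (K i * a)) -> (forall i a, P a -> P (x i * a)) ->
  forall a, P a.
Proof.
move=> P_lin P1 PK Px a.
have P0 : P 0 by rewrite -[0](addNr 1) -scaleN1r; apply: P_lin.
rewrite (coord_span (taft_span a)).
apply: big_ind => [//|u v Pu Pv|m _]; first by rewrite -[u]scale1r; apply: P_lin.
rewrite -[_ *: _]addr0; apply: P_lin => //; rewrite taft_basisE KmonE.
by apply: prod_pow_ind => //; rewrite -[Km _]mulr1; apply: prod_pow_ind.
Qed.

End TaftBasis.

(** * Matrices sending each basis vector to a multiple of a basis vector *)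

Section MonomialMatrices.
Variables (k : fieldType) (T : finType) (t0 : T).

(** The size is written as a successor so that the square matrices form a unital algebra; [t0]
    witnesses that [T] is nonempty. *)
Let N := #|T|.-1.
Let rk (t : T) : 'I_N.+1 := inord (enum_rank t).
Let ev (i : 'I_N.+1) : T := nth t0 (enum T) i.

Let card_gt0 : N.+1 = #|T|.
Proof. by apply: prednK; apply/card_gt0P; exists t0. Qed.

Let rkK : cancel rk ev.
Proof.
move=> t; rewrite /ev /rk inordK ?card_gt0 // -[RHS](enum_rankK t).
by rewrite (enum_val_nth t0).
Qed.

Let rk_inj : injective rk. Proof. exact: can_inj rkK. Qed.

(* The operator e_t |-> w t *: e_(s t) on the space with basis e_t, t : T.    *)
Definition mono_mx (w : T -> k) (s : T -> T) : 'M[k]_N.+1 :=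
  \matrix_(i, j) (w (ev j) *+ (i == rk (s (ev j)))).

Definition mono_vec (t : T) : 'cV[k]_N.+1 := delta_mx (rk t) 0.

Lemma mono_mxP (M M' : 'M[k]_N.+1) :
  (forall t, M *m mono_vec t = M' *m mono_vec t) -> M = M'.
Proof.
move=> eqM; apply/matrixP => i j.
have ->: j = rk (ev j).
  apply: val_inj; rewrite /= inordK ?card_gt0 //.
  have j_lt : (j < #|T|)%N by rewrite -card_gt0.
  rewrite -[nat_of_ord j]/(nat_of_ord (Ordinal j_lt)).
  have -> : ev j = enum_val (Ordinal j_lt) by rewrite (enum_val_nth t0).
  by rewrite enum_valK.
have /colP/(_ i) := eqM (ev j); rewrite !mxE (bigD1 (rk (ev j))) //= big1 ?addr0.
  rewrite [in RHS](bigD1 (rk (ev j))) //= big1 ?addr0.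
    by rewrite !mxE eqxx !mulr1.
  by move=> c /negPf ne_c; rewrite !mxE ne_c mulr0.
by move=> c /negPf ne_c; rewrite !mxE ne_c mulr0.
Qed.

Lemma mono_mxE w s t : mono_mx w s *m mono_vec t = w t *: mono_vec (s t).
Proof.
apply/colP => i; rewrite !mxE (bigD1 (rk t)) //= big1 ?addr0.
  by rewrite !mxE rkK eqxx !andbT mulr1 mulr_natr.
by move=> c /negPf ne_c; rewrite !mxE ne_c mulr0.
Qed.

Lemma mono_mxX w s m t : mono_mx w s ^+ m *m mono_vec t =
  (\prod_(i < m) w (iter i s t)) *: mono_vec (iter m s t).
Proof.
elim: m => [|m IHm]; first by rewrite big_ord0 scale1r expr0 mul1mx.
rewrite exprS -[_ * _]/(_ *m _) -mulmxA IHm -scalemxAr mono_mxE scalerA.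
by rewrite big_ord_recr.
Qed.

Lemma mono_vec_free (c : T -> k) :
  \sum_t c t *: mono_vec t = 0 -> forall t, c t = 0.
Proof.
move=> c0 t; have /colP/(_ (rk t)) := c0.
rewrite summxE (bigD1 t) //= big1 ?addr0 => [|t' /negPf ne_t].
  by rewrite !mxE !eqxx mulr1.
by rewrite !mxE (inj_eq rk_inj) eq_sym ne_t mulr0.
Qed.

End MonomialMatrices.

(** * Cyclic shifts of exponent vectors *)

Section BoxShift.
Variables (n l : nat) (l_gt0 : (0 < l)%N).

(** The shift wraps around at [l]. This is right for exponents of [K i]; for those of [x i] the
    model below puts weight 0 on the wrap. *)
Definition box_shift (i : 'I_n) (g : box n l) : box n l :=
  \row_j (if j == i then ordS (g 0 j) else g 0 j).

Definition box0 : box n l := const_mx (Ordinal l_gt0).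

Lemma iter_box_shift m i g j :
  iter m (box_shift i) g 0 j =
    (if j == i then (g 0%R j + m) %% l else g 0%R j)%N :> nat.
Proof.
elim: m => [|m IHm] /=; first by case: ifP => // _; rewrite addn0 modn_small.
rewrite mxE; case: eqP IHm => //= _ ->.
by rewrite -addn1 modnDml addn1 addnS.
Qed.

Lemma box_shiftE i (g : box n l) j : ((g 0%R i).+1 < l)%N ->
  box_shift i g 0 j = (g 0%R j + (j == i))%N :> nat.
Proof.
move=> gi; rewrite -[box_shift i g]/(iter 1 (box_shift i) g) iter_box_shift.
by case: eqP => [->|_]; rewrite ?addn0 // modn_small ?addn1.
Qed.

Lemma box_shiftC i j g : box_shift i (box_shift j g) = box_shift j (box_shift i g).
Proof.
apply/rowP => m; rewrite !mxE.
by case: (m == i); case: (m == j).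
Qed.

Lemma iter_box_shift_l i g : iter l (box_shift i) g = g.
Proof.
apply/rowP => j; apply: val_inj; rewrite /= iter_box_shift; case: ifP => // _.
by rewrite modnDr modn_small.
Qed.

Lemma prod_box_shift (R : comNzRingType) (P : pred 'I_n) (u : 'I_n -> R) i
    (g : box n l) :
  ((g 0%R i).+1 < l)%N ->
  \prod_(j | P j) u j ^+ box_shift i g 0 j =
  (\prod_(j | P j) u j ^+ g 0 j) * (if P i then u i else 1).
Proof.
move=> gi; have -> : (if P i then u i else 1) = \prod_(j | P j) u j ^+ (j == i).
  case: ifP => Pi; last first.
    by rewrite big1 // => j Pj; case: eqP Pj => [->|//]; rewrite Pi.
  by rewrite (bigD1 i) //= eqxx big1 ?mulr1 // => j /andP[_ /negPf ->].
by rewrite -big_split; apply: eq_bigr => j _; rewrite box_shiftE // exprD.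
Qed.

Lemma prod_shift_vec (k : fieldType) (N : nat) (M : 'I_n -> 'M[k]_N.+1)
    (e : box n l -> 'cV[k]_N.+1) :
  (forall i (g : box n l), ((g 0%R i).+1 < l)%N ->
     exists2 s : k, s != 0 & M i *m e g = s *: e (box_shift i g)) ->
  forall c : box n l,
  exists2 s : k, s != 0 & (\prod_i M i ^+ c 0 i) *m e box0 = s *: e c.
Proof.
move=> Me c.
(* [cr r] agrees with [c] on the indices in [r] and is 0 elsewhere. The leftmost factor of the
   product acts last, so induction on the list of indices raises one coordinate at a time, from 0 to
   its value in [c]. *)
pose cr (r : seq 'I_n) : box n l := \row_j (if j \in r then c 0 j else box0 0 j).
suff [s s0 Hs] : exists2 s : k, s != 0 &
    (\prod_(i <- index_enum 'I_n) M i ^+ c 0 i) *m e box0 =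
      s *: e (cr (index_enum 'I_n)).
  exists s => //; rewrite Hs; congr (_ *: e _); apply/rowP => j.
  by rewrite mxE mem_index_enum.
elim: (index_enum _) (index_enum_uniq 'I_n) => [_ | i r IHr /= /andP[ir Ur]].
  exists 1; rewrite ?oner_neq0 // big_nil mul1mx scale1r.
  by congr (e _); apply/rowP => j; rewrite !mxE.
have [s s0 Hs] := IHr Ur.
suff /(_ _ (leqnn _)) [s' s'0 Hs'] : forall m, (m <= c 0%R i)%N ->
    exists2 s' : k, s' != 0 &
      M i ^+ m *m e (cr r) = s' *: e (iter m (box_shift i) (cr r)).
  exists (s * s'); first by rewrite mulf_neq0.
  rewrite big_cons -mulmxA Hs -scalemxAr Hs' scalerA; congr (_ *: e _).
  apply/rowP => j; apply: val_inj; rewrite /= iter_box_shift !mxE inE.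
  by case: eqVneq => [->|_] //=; rewrite (negPf ir) add0n modn_small.
elim=> [|m IHm] m_le.
  by exists 1; rewrite ?oner_neq0 // mul1mx scale1r.
have [s' s'0 Hs'] := IHm (ltnW m_le).
have [|s2 s20 Hs2] := Me i (iter m (box_shift i) (cr r)).
  rewrite iter_box_shift eqxx mxE (negPf ir) mxE add0n modn_small.
    exact: leq_ltn_trans m_le (ltn_ord _).
  exact: ltn_trans m_le (ltn_ord _).
exists (s' * s2); first by rewrite mulf_neq0.
by rewrite exprS -mulmxA Hs' -scalemxAr Hs2 scalerA.
Qed.

End BoxShift.

(** * A matrix model of the algebra *)

Section TaftModel.
Variables (k : fieldType) (n l : nat) (q : k) (q_prim : l.-primitive_root q).

Let l_gt0 : (0 < l)%N := prim_gt0 q_prim.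
Let T := (box n l * box n l)%type.
Let t0 : T := (box0 n l_gt0, box0 n l_gt0).

Let th (i j : 'I_n) := theta q (eps i) (eps j).
(** The model imitates left multiplication on the expected basis, with e_(c,b) for x^c K(b). The
    weight [kw] arises from moving [K i] past x^c, and [xw] from moving [x i] past the powers of
    [x j] with j < i; [xw] is 0 when the exponent of [x i] would reach [l]. *)
Let kw (i : 'I_n) (t : T) := \prod_j (th i j * q ^+ (i == j)) ^+ t.1 0 j.
Let xw (i : 'I_n) (t : T) :=
  if ((t.1 0%R i).+1 < l)%N then \prod_(j < n | (j < i)%N) th i j ^+ t.1 0 j
  else 0.
Let ks (i : 'I_n) (t : T) : T := (t.1, box_shift i t.2).
Let xs (i : 'I_n) (t : T) : T := (box_shift i t.1, t.2).

Definition model_K i := mono_mx t0 (kw i) (ks i).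
Definition model_x i := mono_mx t0 (xw i) (xs i).
Definition model_K' i := model_K i ^+ l.-1.

Let th_neq0 i j : th i j != 0. Proof. exact: theta_neq0 q_prim _ _. Qed.
Let q_neq0 : q != 0. Proof. exact: prim_neq0 q_prim. Qed.

Let thN i j : th i j * th j i = 1.
Proof. by rewrite /th /theta -expfzDr // addrC subrKA subrr. Qed.

Let thl i j : th i j ^+ l = 1.
Proof.
rewrite /th /theta -[_ ^+ l]/(_ ^ l%:Z) exprz_exp mulrC -exprz_exp.
by rewrite -[q ^ l%:Z]/(q ^+ l) (prim_expr_order q_prim) exp1rz.
Qed.

Let kw_neq0 i (t : T) : kw i t != 0.
Proof.
by apply/prodf_neq0 => j _; rewrite expf_neq0 // mulf_neq0 // expf_neq0.
Qed.

Let xw_neq0 i (t : T) : ((t.1 0%R i).+1 < l)%N -> xw i t != 0.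
Proof. by rewrite /xw => ->; apply/prodf_neq0 => j _; rewrite expf_neq0. Qed.

(** This asymmetry makes the model skew-commutative: of the two orders of [x i] and [x j], exactly
    one picks up a factor theta. *)
Let xw_shift i j (t : T) : i != j -> ((t.1 0%R j).+1 < l)%N ->
  xw i (xs j t) = xw i t * (if (j < i)%N then th i j else 1).
Proof.
move=> ne_ij tj; rewrite /xw /= box_shiftE // (negPf ne_ij) addn0.
by case: ifP; rewrite ?mul0r // prod_box_shift.
Qed.

Lemma model_KE i (t : T) :
  model_K i *m mono_vec k t = kw i t *: mono_vec k (ks i t).
Proof. exact: mono_mxE. Qed.

Lemma model_xE i (t : T) :
  model_x i *m mono_vec k t = xw i t *: mono_vec k (xs i t).
Proof. exact: mono_mxE. Qed.

(** The weight is constant along the orbit of the shift and is an [l]-th root of unity. *)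
Lemma model_Kl i : model_K i ^+ l = 1.
Proof.
apply: (@mono_mxP _ _ t0) => t; rewrite mono_mxX mul1mx.
have iter_ks m : iter m (ks i) t = (t.1, iter m (box_shift i) t.2).
  by elim: m => [|m IHm] /=; [case: t | rewrite IHm].
rewrite iter_ks iter_box_shift_l -surjective_pairing.
rewrite (eq_bigr (fun=> kw i t)) => [|m _]; last by rewrite iter_ks.
rewrite prodr_const card_ord -prodrXl big1 ?scale1r // => j _.
by rewrite exprAC exprMn thl mul1r [X in X ^+ _]exprAC (prim_expr_order q_prim) !expr1n.
Qed.

Lemma model_xl i : model_x i ^+ l = 0.
Proof.
apply: (@mono_mxP _ _ t0) => t; rewrite mono_mxX mul0mx.
have iter_xs m : iter m (xs i) t = (iter m (box_shift i) t.1, t.2).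
  by elim: m => [|m IHm] /=; [case: t | rewrite IHm].
(* After this many shifts the exponent of [x i] is l - 1, where the weight is 0; so one factor of
   the product of weights vanishes. *)
have ti_lt : (l.-1 - t.1 0%R i < l)%N.
  by apply: leq_ltn_trans (leq_subr _ _) _; rewrite prednK.
suff xw0 : xw i (iter (l.-1 - t.1 0%R i) (xs i) t) = 0.
  by rewrite (bigD1 (Ordinal ti_lt)) //= xw0 mul0r scale0r.
rewrite iter_xs /xw /= iter_box_shift eqxx subnKC; last by rewrite -ltnS prednK.
by rewrite modn_small prednK // ltnn.
Qed.

Lemma model_rel : taft_relations l q model_K model_K' model_x.
Proof.
have KV i : model_K i * model_K' i = 1 by rewrite -exprS (prednK l_gt0) model_Kl.
have VK i : model_K' i * model_K i = 1 by rewrite -exprSr (prednK l_gt0) model_Kl.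
split=> [i j|i|i|i|i j|i j|i]; rewrite ?KV ?VK //.
- apply: (@mono_mxP _ _ t0) => t; rewrite -!mulmxA !model_KE -!scalemxAr !model_KE.
  by rewrite !scalerA mulrC /ks /= box_shiftC.
- exact: model_Kl.
- suff -> : model_K i * model_x j = (th i j * q ^+ (i == j)) *: (model_x j * model_K i).
    by rewrite -scalerAl -mulrA KV mulr1.
  apply: (@mono_mxP _ _ t0) => t; rewrite -scalemxAl -!mulmxA model_KE model_xE.
  rewrite -!scalemxAr model_KE model_xE !scalerA /xs /ks /=.
  rewrite /xw /=; case: ifP => tj; last by rewrite mul0r mulr0 scale0r.
  rewrite {1}/kw /= prod_box_shift // -/(kw i t) mulrC; congr (_ * _ *: _).
  by rewrite mulrC.
- apply: (@mono_mxP _ _ t0) => t; rewrite -scalemxAl -!mulmxA !model_xE.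
  rewrite -!scalemxAr !model_xE !scalerA /xs /= box_shiftC; congr (_ *: _).
  have [<-|ne_ij] := eqVneq i j; first by rewrite /theta subrr expr0z mul1r.
  have ne_ji : j != i by rewrite eq_sym.
  have xw0 i' j' (u : T) : i' != j' -> ((u.1 0%R i').+1 < l)%N = false ->
      xw i' u = 0 /\ xw i' (xs j' u) = 0.
    move=> ne_ij' ui; rewrite /xw /= mxE (negPf ne_ij') ui; split=> //.
  have [tj|/negbTE tj] := boolP ((t.1 0%R j).+1 < l)%N; last first.
    by have [-> ->] := xw0 j i t ne_ji tj; rewrite !(mul0r, mulr0).
  have [ti|/negbTE ti] := boolP ((t.1 0%R i).+1 < l)%N; last first.
    by have [-> ->] := xw0 i j t ne_ij ti; rewrite !(mul0r, mulr0).
  rewrite xw_shift // xw_shift // -!/(th _ _).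
  case: (ltngtP i j) => [ij|ij|/val_inj ij]; last by rewrite ij eqxx in ne_ij.
    by rewrite [xw j t * th j i]mulrC mulrACA thN mul1r mulr1 mulrC.
  by rewrite mulr1 mulrC [xw i t * _]mulrC.
- exact: model_xl.
Qed.

(** Distinct monomials send the vector at exponent zero to nonzero multiples of distinct basis
    vectors. *)
Lemma model_monomial (c b : box n l) : exists2 s : k, s != 0 &
  (\prod_i model_x i ^+ c 0 i * \prod_i model_K i ^+ b 0 i) *m mono_vec k t0 =
  s *: mono_vec k (c, b).
Proof.
have [|s s0 Hs] := @prod_shift_vec _ _ l_gt0 _ _ model_K
    (fun g => mono_vec k (box0 n l_gt0, g)) _ b.
  by move=> i g _; exists (kw i (box0 n l_gt0, g)); rewrite ?model_KE.
have [|s' s'0 Hs'] := @prod_shift_vec _ _ l_gt0 _ _ model_x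
    (fun g => mono_vec k (g, b)) _ c.
  move=> i g gi; exists (xw i (g, b)); last by rewrite model_xE.
  exact: xw_neq0.
exists (s * s'); first by rewrite mulf_neq0.
by rewrite -mulmxA Hs -scalemxAr Hs' scalerA.
Qed.

End TaftModel.

(** * Linear independence of the monomials *)

Section TaftFree.
Variables (k : fieldType) (n l : nat) (q : k) (q_prim : l.-primitive_root q).
Variables (A : falgType k) (K K' x : 'I_n -> A).
Hypothesis A_pres : taft_presented l q K K' x.

(** The universal property maps [A] to the matrix model. A linear relation between monomials,
    applied to the vector at exponent zero, becomes by [model_monomial] a relation between distinct
    basis vectors. *)
Lemma taft_free : free (taft_basis l K x).
Proof.
have [f [fK _ fx]] := taft_lift A_pres (model_rel n q_prim).
pose l_gt0 := prim_gt0 q_prim.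
pose t0 : box n l * box n l := (box0 n l_gt0, box0 n l_gt0).
apply/freeP => c c0 m.
have fb (m' : 'I_#|{: box n l * box n l}|) : exists2 s : k, s != 0 &
    f (taft_basis l K x)`_m' *m mono_vec k t0 = s *: mono_vec k (enum_val m').
  have [s s0 Hs] := model_monomial q_prim (enum_val m').1 (enum_val m').2.
  exists s; rewrite // [enum_val m']surjective_pairing -Hs; congr (_ *m _).
  rewrite taft_basisE KmonE rmorphM !rmorph_prod; congr (_ * _).
    by apply: eq_bigr => i _; rewrite rmorphXn /= fx.
  by apply: eq_bigr => i _; rewrite rmorphXn /= fK.
have /fin_all_exists[s Hs] (m' : 'I_#|{: box n l * box n l}|) :
    exists s : k, s != 0 /\
    f (taft_basis l K x)`_m' *m mono_vec k t0 = s *: mono_vec k (enum_val m').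
  by have [s s0 Hs] := fb m'; exists s.
pose d t := c (enum_rank t) * s (enum_rank t).
have d0 : \sum_t d t *: mono_vec k t = 0.
  have := congr1 (fun a => f a *m mono_vec k t0) c0.
  rewrite /= linear0 mul0mx linear_sum mulmx_suml => H; rewrite -[RHS]H.
  rewrite (reindex (fun m : 'I_#|{: box n l * box n l}| => enum_val m)) /=.
    2: by apply: onW_bij; apply: enum_val_bij.
  apply: eq_bigr => m' _; rewrite /d enum_valK linearZ /= -scalemxAl.
  by rewrite (Hs m').2 scalerA.
have /eqP := mono_vec_free t0 d0 (enum_val m).
by rewrite /d enum_valK mulf_eq0 (negPf (Hs m).1) orbF => /eqP.
Qed.

(* The coordinates on the basis are meaningful only now that it is free.      *)
Definition taft_coord (c b : box n l) : dual A :=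
  linfun (fun h => coord (taft_basis l K x) (enum_rank (c, b)) h : k^o).

Lemma taft_coordE c b c' b' :
  taft_coord c b (xmon x c' * Kmon K (box_val b')) =
  (((c', b') : box n l * box n l) == (c, b))%:R.
Proof.
rewrite linfunP; last by move=> a u v; rewrite linearP.
have -> : xmon x c' * Kmon K (box_val b') =
    (taft_basis l K x)`_(enum_rank (c', b')) by rewrite taft_basisE enum_rankK.
by rewrite coord_free ?taft_free // (inj_eq enum_rank_inj).
Qed.

Lemma Kdual_basis (a c b : box n l) :
  Kdual l q K x (box_val a) (xmon x c * Kmon K (box_val b)) =
  if box_val c == 0 then q ^ pairing (box_val a) (box_val b) else 0.
Proof.
rewrite linfunP; last first.
  move=> s u v; rewrite scaler_sumr -big_split; apply: eq_bigr => m _ /=.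
  by rewrite linearP mulrDl -scalerAl.
have bE : xmon x c * Kmon K (box_val b) =
    (taft_basis l K x)`_(enum_rank (c, b)) by rewrite taft_basisE enum_rankK.
rewrite (bigD1 (enum_rank (c, b))) //= big1 ?addr0 => [|m ne_m].
  by rewrite {1}bE coord_free ?taft_free // eqxx mul1r enum_rankK.
by rewrite bE coord_free ?taft_free // eq_sym (negPf ne_m) mul0r.
Qed.

(** [Kdual] is defined by coordinates, so its multiplicativity is not visible. The presentation
    supplies an algebra map with the expected values on generators, and the two agree on the
    basis. *)
Lemma Kdual_char (a : box n l) : exists f : {lrmorphism A -> k^o},
  [/\ Kdual l q K x (box_val a) =1 f, forall i, f (K i) = q ^+ (a 0 i : nat)
    & forall i, f (x i) = 0].
Proof.
have q0 := prim_neq0 q_prim.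
have rel_a : @taft_relations k n l q k^o
    (fun i => q ^+ (a 0 i : nat)) (fun i => q ^- (a 0 i : nat)) (fun=> 0).
  split=> [i j|i|i|i|i j|i j|i]; rewrite ?(mulr0, mul0r, scaler0) //.
  - by rewrite mulrC.
  - by rewrite mulfV // expf_neq0.
  - by rewrite mulVf // expf_neq0.
  - by rewrite exprAC (prim_expr_order q_prim) expr1n.
  - by rewrite expr0n gtn_eqF ?(prim_gt0 q_prim).
have [f [fK _ fx]] := taft_lift A_pres rel_a.
exists f; split=> // h; rewrite (coord_span (taft_span q_prim A_pres h)).
rewrite !linear_sum; apply: eq_bigr => m _; rewrite !linearZ /=; congr (_ *: _).
rewrite taft_basisE; set c := (enum_val m).1; set b := (enum_val m).2.
rewrite Kdual_basis rmorphM /xmon KmonE !rmorph_prod.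
have fKm : \prod_(i < n) f (K i ^+ b 0 i) = q ^ pairing (box_val a) (box_val b).
  have -> : pairing (box_val a) (box_val b) = Posz (\sum_i a 0%R i * b 0%R i)%N.
    rewrite /pairing (big_morph Posz PoszD (erefl _)); apply: eq_bigr => i _.
    by rewrite !mxE.
  rewrite -[RHS]/(q ^+ _) -prodrXr; apply: eq_bigr => i _.
  by rewrite rmorphXn /= fK exprM.
have -> : (box_val c == 0) = [forall i, c 0 i == 0%N :> nat].
  apply/eqP/forallP => [c0 i|c0].
    by have /rowP/(_ i) := c0; rewrite !mxE => -[->].
  by apply/rowP => i; rewrite !mxE; have /eqP -> := c0 i.
case: ifPn => [/forallP c0|/forallPn [i ci]].
  rewrite [X in X * _]big1 ?mul1r // => i _.
  by rewrite (eqP (c0 i)) expr0 rmorph1.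
rewrite (bigD1 i) //= rmorphXn /= fx expr0n.
by rewrite (negPf ci) !mul0r.
Qed.

End TaftFree.

(** * The antipode and the product of the double *)

Section HopfLemmas.
Variables (k : fieldType) (H : falgType k) (S : hopf_algebra H).
Implicit Types (a b c g h : H) (p r : dual H).

Definition trilinear_fun (W : lmodType k) (f : H -> H -> H -> W) : Prop :=
  [/\ forall b c, linear (fun a => f a b c), forall a c, linear (fun b => f a b c)
    & forall a b, linear (f a b)].

Lemma sweedler_mul_bilinear (W : lmodType k) (f : H -> H -> W) h :
  bilinear_fun f ->
  bilinear_fun (fun a b => sweedler2 S (fun a' b' => f (a * a') (b * b')) h).
Proof.
case=> f_l f_r; split=> [b c u v|a c u v]; rewrite -sweedler_comb;
  apply: eq_sweedler => a' b'; rewrite mulrDl -scalerAl; [exact: f_l|exact: f_r].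
Qed.

Lemma sweedler2_comp1 (W : lmodType k) (f : H -> H -> H -> W) :
  trilinear_fun f ->
  bilinear_fun (fun a c => sweedler2 S (fun b1 b2 => f b1 b2 c) a).
Proof.
case=> f1 f2 f3; split=> [c|a c u v]; first exact: sweedler_lin.
by rewrite -sweedler_comb; apply: eq_sweedler => b1 b2; apply: f3.
Qed.

Lemma trilinear12 (W : lmodType k) (f : H -> H -> H -> W) c :
  trilinear_fun f -> bilinear_fun (fun a b => f a b c).
Proof. by case=> f1 f2 f3; split=> b; [apply: f1 | apply: f2]. Qed.

Lemma sweedler0 (W : lmodType k) h : sweedler2 S (fun _ _ => 0 : W) h = 0.
Proof. by apply: big1 => i _; apply: big1 => j _; rewrite scaler0. Qed.

(* A left convolution inverse of the identity is unique; this is the linear   *)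
(* form of that statement.                                                    *)
Lemma convid_eq0 (T : H -> H) : linear T ->
  (forall h, sweedler2 S (fun a b => T a * b) h = 0) -> forall h, T h = 0.
Proof.
move=> T_lin T0 h.
have T3 : trilinear_fun (fun a b c => T a * b * antip S c).
  split=> b c s u v /=; first by rewrite T_lin !mulrDl -!scalerAl.
    by rewrite mulrDr mulrDl -scalerAr -scalerAl.
  by rewrite linearP mulrDr scalerAr.
have [T31 T32 T33] := T3.
rewrite -[in LHS](cop_counitr S h) (tlift_comp _ _ T_lin).
(* The expression T(h_(1)) h_(2) s(h_(3)) is evaluated in two ways: contracting the last two factors
   gives T(h), contracting the first two gives 0. *)
transitivity (sweedler3 S (fun a b c => T a * b * antip S c) h).
  rewrite sweedlerA //; apply: eq_tlift => a b.
  transitivity (T a * (counit S b)%:A); first by rewrite linearZf // mulr_algr.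
  rewrite -antipr (tlift_comp (fun b1 b2 => b1 * antip S b2) _ (L := fun u => T a * u)).
    by apply: eq_tlift => b1 b2; rewrite mulrA.
  by move=> s u v; rewrite mulrDr scalerAr.
rewrite -[RHS](sweedler0 H h).
apply: eq_sweedler => a c.
rewrite -(mul0r (antip S c)) -(T0 a).
rewrite (sweedler_comp S (fun b1 b2 => T b1 * b2) _ (L := fun u => u * antip S c)) //.
by move=> s u v; rewrite mulrDl scalerAl.
Qed.

Lemma antip1 : antip S 1 = 1.
Proof.
have := antipl S 1; rewrite counit1 scale1r -/(sweedler2 S _ _).
rewrite (sweedler_tens _ (cop1 S)) ?mulr1 //; split=> b c u v.
  by rewrite linearP mulrDl -scalerAl.
by rewrite mulrDr -scalerAr.
Qed.

Definition hit a p b : dual H := hitr (hitl a p) b.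

Lemma hitE a p b y : hit a p b y = p (b * y * a).
Proof. by rewrite hitrE hitlE. Qed.

Lemma conv_linl r : linear (fun p => conv S p r).
Proof.
move=> c u v; apply: dualP => h; rewrite !lfun_simp !convE -sweedler_comb.
by apply: eq_sweedler => a b; rewrite !lfun_simp mulrDl scalerAl.
Qed.

Lemma conv_linr p : linear (conv S p).
Proof.
move=> c u v; apply: dualP => h; rewrite !lfun_simp !convE -sweedler_comb.
by apply: eq_sweedler => a b; rewrite !lfun_simp mulrDr scalerAr.
Qed.

Lemma hit_linl p b : linear (fun a => hit a p b).
Proof.
by move=> c u v; apply: dualP => h; rewrite !(lfun_simp, hitE) mulrDr -scalerAr linearP.
Qed.

Lemma hit_linm a b : linear (fun p => hit a p b).
Proof. by move=> c u v; apply: dualP => h; rewrite !(lfun_simp, hitE). Qed.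

Lemma hit_linr a p : linear (hit a p).
Proof.
move=> c u v; apply: dualP => h; rewrite !(lfun_simp, hitE).
by rewrite !mulrDl -!scalerAl linearP.
Qed.

Lemma sinv_lin : linear (sinv S).
Proof. by move=> c u v; rewrite /sinv linearP. Qed.

Lemma ddterm_trilinear p p' h' : trilinear_fun (fun h1 h2 h3 =>
  tens (conv S p (hit h1 p' (sinv S h3))) (h2 * h') : drinfeld H).
Proof.
split=> [b d|b d|b d] c u v.
- by rewrite (hit_linl p' (sinv S d) c u v) conv_linr; apply: tensPl.
- by rewrite mulrDl -scalerAl; apply: tensPr.
- by rewrite sinv_lin hit_linr conv_linr; apply: tensPl.
Qed.

Lemma ddmulE p h p' h' : ddmul S (tens p h) (tens p' h') =
  sweedler3 S (fun h1 h2 h3 =>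
    tens (conv S p (hit h1 p' (sinv S h3))) (h2 * h') : drinfeld H) h.
Proof.
have E r g : tlift (fun (p' : dual H) (h' : H) =>
      sweedler3 S (fun h1 h2 h3 =>
        tens (conv S r (hit h1 p' (sinv S h3))) (h2 * h') : drinfeld H) g)
    (tens p' h') = sweedler3 S (fun h1 h2 h3 =>
        tens (conv S r (hit h1 p' (sinv S h3))) (h2 * h') : drinfeld H) g.
  rewrite tlift_tens // => [h0 c u v|r0 c u v]; rewrite /sweedler3 -sweedler_comb;
    apply: eq_sweedler => a b; rewrite -sweedler_comb; apply: eq_sweedler => b1 b2.
    by rewrite (hit_linm b1 (sinv S b) c u v) conv_linr; apply: tensPl.
  by rewrite mulrDr -scalerAr; apply: tensPr.
rewrite /ddmul (eq_tlift E) tlift_tens // => [h0 c u v|r0]; last exact: sweedler_lin.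
rewrite /sweedler3 -sweedler_comb; apply: eq_sweedler => a b.
rewrite -sweedler_comb; apply: eq_sweedler => b1 b2.
by rewrite (conv_linl (hit b1 p' (sinv S b)) c u v); apply: tensPl.
Qed.

End HopfLemmas.

(** * The antipode and the double on generators *)

Section TaftHopf.
Variables (k : fieldType) (n l : nat) (q : k) (q_prim : l.-primitive_root q).
Variables (A : falgType k) (S : hopf_algebra A) (K K' x : 'I_n -> A).
Hypothesis A_taft : taft_hopf l q S K K' x.

Let A_pres := taft_pres A_taft.
Let KK' := KK'K A_pres.
Let K'K := K'K A_pres.

Lemma sweedler_K (W : lmodType k) (f : A -> A -> W) i :
  bilinear_fun f -> sweedler2 S f (K i) = f (K i) (K i).
Proof. by move=> f2; rewrite (sweedler_tens f2 (taft_copK A_taft i)). Qed.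

Lemma sweedler_x (W : lmodType k) (f : A -> A -> W) i : bilinear_fun f ->
  sweedler2 S f (x i) = f (x i) 1 + f (K i) (x i).
Proof.
case=> f_l f_r; rewrite /sweedler2 (taft_copx A_taft).
by rewrite (linearDf (tlift_is_linear f)) !tlift_tens.
Qed.

Lemma sweedler_1 (W : lmodType k) (f : A -> A -> W) :
  bilinear_fun f -> sweedler2 S f 1 = f 1 1.
Proof. by move=> f2; rewrite (sweedler_tens f2 (cop1 S)). Qed.

Lemma sweedler_KM (W : lmodType k) (f : A -> A -> W) i h : bilinear_fun f ->
  sweedler2 S f (K i * h) = sweedler2 S (fun a b => f (K i * a) (K i * b)) h.
Proof.
move=> f2; rewrite sweedlerM // sweedler_K //.
exact: sweedler_mul_bilinear.
Qed.

Lemma sweedler_xM (W : lmodType k) (f : A -> A -> W) i h : bilinear_fun f ->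
  sweedler2 S f (x i * h) =
  sweedler2 S (fun a b => f (x i * a) b + f (K i * a) (x i * b)) h.
Proof.
move=> f2; rewrite sweedlerM // sweedler_x; last exact: sweedler_mul_bilinear.
by rewrite -sweedlerD; apply: eq_sweedler => a b; rewrite mul1r.
Qed.

Lemma antip_bilinear : bilinear_fun (fun a b => antip S a * b).
Proof.
split=> a c u v; first by rewrite linearP mulrDl -scalerAl.
by rewrite mulrDr -scalerAr.
Qed.

(** By the antipode axiom at [K i * h], both h |-> s(K_i h) K_i and s are left convolution inverses
    of the identity, hence equal. *)
Lemma antipKM i h : antip S (K i * h) = antip S h * K' i.
Proof.
pose T h := antip S (K i * h) * K i - antip S h.
have T_lin : linear T.
  move=> c u v; rewrite /T mulrDr -scalerAr !linearP mulrDl -scalerAl.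
  by rewrite scalerDr addrACA.
suff /eqP : T h = 0 by rewrite subr_eq0 => /eqP <-; rewrite -mulrA KK' mulr1.
apply: (convid_eq0 (S := S)) => // {}h.
transitivity (sweedler2 S (fun a b => antip S a * b) (K i * h) -
    sweedler2 S (fun a b => antip S a * b) h).
  rewrite sweedler_KM; last exact: antip_bilinear.
  rewrite addrC -scaleN1r -sweedler_comb; apply: eq_sweedler => a b.
  by rewrite scaleN1r addrC mulrBl -mulrA.
by rewrite /sweedler2 !antipl counitM (taft_counitK A_taft) mul1r subrr.
Qed.

(** The antipode axiom at [x i * h] reads s(x_i h_(1)) h_(2) + s(K_i h_(1)) x_i h_(2) = 0, and
    [antipKM] rewrites the second term so that [convid_eq0] applies. *)
Lemma antipxM i h : antip S (x i * h) = - (antip S h * (K' i * x i)).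
Proof.
pose T h := antip S (x i * h) + antip S h * (K' i * x i).
have T_lin : linear T.
  move=> c u v; rewrite /T mulrDr -scalerAr !linearP mulrDl -scalerAl.
  by rewrite scalerDr addrACA.
suff /eqP : T h = 0 by rewrite addr_eq0 => /eqP.
apply: (convid_eq0 (S := S)) => // {}h.
transitivity (sweedler2 S (fun a b => antip S a * b) (x i * h)).
  rewrite sweedler_xM; last exact: antip_bilinear.
  by apply: eq_sweedler => a b; rewrite antipKM mulrDl !mulrA.
by rewrite /sweedler2 antipl counitM (taft_counitx A_taft) mul0r scale0r.
Qed.

Lemma antipM g h : antip S (g * h) = antip S h * antip S g.
Proof.
move: g h; apply: (taft_ind q_prim A_pres) => [c u v IHu IHv h||i g IHg h|i g IHg h].
- by rewrite mulrDl -scalerAl !linearP /= IHu IHv mulrDr -scalerAr.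
- by move=> h; rewrite antip1 mulr1 mul1r.
- by rewrite -mulrA !antipKM IHg mulrA.
- by rewrite -mulrA !antipxM IHg mulrN !mulrA.
Qed.

(** Each generator is a value of the antipode, which reverses products; so its image is stable under
    left multiplication by generators. This makes [sinv] a two-sided inverse. *)
Lemma antip_surj h : h \in limg (antip S).
Proof.
move: h; apply: (taft_gen q_prim A_pres) => [|i w|i w].
- by rewrite -(antip1 S); apply/memv_img/memvf.
- case/memv_imgP=> u _ ->.
  by rewrite -(taft_antipV A_taft) -antipM memv_img ?memvf.
- case/memv_imgP=> u _ ->.
  have -> : x i = antip S (- (x i * K' i)).
    rewrite linearN /= antipM (taft_antipV A_taft) (taft_antipx A_taft).
    by rewrite mulrN opprK mulrA KK' mul1r.
  by rewrite -antipM memv_img ?memvf.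
Qed.

Lemma sinvK h : antip S (sinv S h) = h.
Proof. by apply: limg_lfunVK; apply: antip_surj. Qed.

Lemma antip_inj : injective (antip S).
Proof.
have limgT : limg (antip S) = fullv.
  by apply/vspaceP => h; rewrite antip_surj memvf.
apply/lker0P; have := limg_ker_dim (antip S) fullv.
by rewrite limgT capfv => /eqP; rewrite -[X in _ == X]add0n eqn_add2r dimv_eq0.
Qed.

Lemma sinvM g h : sinv S (g * h) = sinv S h * sinv S g.
Proof. by apply: antip_inj; rewrite antipM !sinvK. Qed.

Lemma sinv1 : sinv S 1 = 1.
Proof. by apply: antip_inj; rewrite sinvK antip1. Qed.

Lemma sinv_K i : sinv S (K i) = K' i.
Proof. by apply: antip_inj; rewrite sinvK (taft_antipV A_taft). Qed.

Lemma sinv_x i : sinv S (x i) = - (x i * K' i).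
Proof.
apply: antip_inj; rewrite sinvK linearN /= antipM (taft_antipV A_taft).
by rewrite (taft_antipx A_taft) mulrN opprK mulrA KK' mul1r.
Qed.

Lemma ddmul_1 (p p' : dual A) h' :
  ddmul S (tens p (1 : A)) (tens p' h') = tens (conv S p p') h'.
Proof.
have f3 := ddterm_trilinear S p p' h'.
rewrite ddmulE /sweedler3 sweedler_1; last exact: sweedler2_comp1.
rewrite sweedler_1 ?mul1r; last exact: trilinear12 f3.
by congr (tens (conv S p _) _); apply: dualP => a; rewrite hitE sinv1 mul1r mulr1.
Qed.

Lemma ddmul_K i (p' : dual A) h' :
  ddmul S (tens (counit S : dual A) (K i)) (tens p' h') =
  tens (hit (K i) p' (K' i)) (K i * h').
Proof.
have f3 := ddterm_trilinear S (counit S) p' h'.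
rewrite ddmulE /sweedler3 sweedler_K; last exact: sweedler2_comp1.
rewrite sweedler_K; last exact: trilinear12 f3.
by rewrite conv_counitl sinv_K.
Qed.

(** The three summands come from the iterated coproduct x (x) 1 (x) 1 + K (x) x (x) 1 + K (x) K (x)
    x of [x i]. *)
Lemma ddmul_x i (p' : dual A) h' :
  ddmul S (tens (counit S : dual A) (x i)) (tens p' h') =
  tens (hit (x i) p' 1) h' + tens (hit (K i) p' 1) (x i * h')
  + tens (hit (K i) p' (- (x i * K' i))) (K i * h').
Proof.
have f3 := ddterm_trilinear S (counit S) p' h'.
rewrite ddmulE /sweedler3 sweedler_x; last exact: sweedler2_comp1.
rewrite sweedler_x; last exact: trilinear12 f3.
rewrite sweedler_K; last exact: trilinear12 f3.
by rewrite !conv_counitl sinv1 sinv_x mul1r.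
Qed.

End TaftHopf.

(** * Modules over the double *)

Section DoubleModule.
Variables (k : fieldType) (n l : nat) (q : k) (q_prim : l.-primitive_root q).
Variables (A : falgType k) (S : hopf_algebra A) (K K' x : 'I_n -> A).
Hypothesis A_taft : taft_hopf l q S K K' x.
Variables (V : lmodType k) (act : drinfeld A -> V -> V).
Hypothesis V_module : dd_module S act.

Let A_pres := taft_pres A_taft.
Let KK' := KK'K A_pres.
Let K'K := K'K A_pres.

(** The restrictions of the action to [A] and to its dual inside the double. By [dual_act_alg] they
    determine the action on all pure tensors. *)
Definition alg_act (h : A) (v : V) : V := act (tens (counit S : dual A) h) v.
Definition dual_act (p : dual A) (v : V) : V := act (tens p (1 : A)) v.

Lemma alg_act_linr h : linear (alg_act h). Proof. exact: dd_actr V_module _. Qed.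
Lemma dual_act_linr p : linear (dual_act p). Proof. exact: dd_actr V_module _. Qed.

Lemma alg_act_linl v : linear (alg_act^~ v).
Proof.
move=> c g h; rewrite /alg_act (tensPr (counit S : dual A) c g h).
exact: (dd_actl V_module).
Qed.

Lemma dual_act_linl v : linear (dual_act^~ v).
Proof.
move=> c p r; rewrite /dual_act (tensPl (1 : A) c p r); exact: (dd_actl V_module).
Qed.

Lemma alg_act1 v : alg_act 1 v = v. Proof. exact: dd_act1 V_module v. Qed.

Lemma dual_actM p r v : dual_act p (dual_act r v) = dual_act (conv S p r) v.
Proof. by rewrite /dual_act -(dd_actM V_module) (ddmul_1 q_prim A_taft). Qed.

Lemma dual_act_alg p h v : dual_act p (alg_act h v) = act (tens p h) v.
Proof.
by rewrite /dual_act /alg_act -(dd_actM V_module) (ddmul_1 q_prim A_taft) conv_counitr.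
Qed.

Lemma counit_hit a b (c : k) : counit S a * counit S b = c ->
  hit a (counit S) b = c *: (counit S : dual A).
Proof.
move=> <-; apply: dualP => y; rewrite hitE !lfun_simp !counitM.
by rewrite mulrC mulrA.
Qed.

Lemma alg_act_KM i h v : alg_act (K i * h) v = alg_act (K i) (alg_act h v).
Proof.
rewrite /alg_act -(dd_actM V_module) (ddmul_K q_prim A_taft) (@counit_hit _ _ 1).
  by rewrite scale1r.
by rewrite (taft_counitK A_taft) (taft_counitV A_taft) mulr1.
Qed.

Lemma alg_act_xM i h v : alg_act (x i * h) v = alg_act (x i) (alg_act h v).
Proof.
rewrite /alg_act -(dd_actM V_module) (ddmul_x q_prim A_taft).
rewrite (@counit_hit (x i) _ 0) ?(taft_counitx A_taft) ?mul0r //.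
rewrite (@counit_hit (K i) 1 1) ?(taft_counitK A_taft) ?counit1 ?mulr1 //.
rewrite (@counit_hit (K i) _ 0); last first.
  by rewrite linearN /= counitM (taft_counitx A_taft) mul0r oppr0 mulr0.
rewrite !scale0r !scale1r (linear0f (tensPl _)) (linear0f (tensPl _)).
by rewrite add0r addr0.
Qed.

Lemma alg_actM g h v : alg_act (g * h) v = alg_act g (alg_act h v).
Proof.
move: g; apply: (taft_ind q_prim A_pres) => [c u w IHu IHw||i g IHg|i g IHg].
- by rewrite mulrDl -scalerAl !alg_act_linl IHu IHw.
- by rewrite mul1r alg_act1.
- by rewrite -mulrA !alg_act_KM IHg.
- by rewrite -mulrA !alg_act_xM IHg.
Qed.

Lemma alg_act_K_dual i p v : alg_act (K i) (dual_act p v) =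
  dual_act (hit (K i) p (K' i)) (alg_act (K i) v).
Proof.
by rewrite dual_act_alg /alg_act /dual_act -(dd_actM V_module) (ddmul_K q_prim A_taft) mulr1.
Qed.

Lemma alg_act_x_dual i p v : alg_act (x i) (dual_act p v) =
  dual_act (hit (x i) p 1) v + dual_act (hit (K i) p 1) (alg_act (x i) v)
  + dual_act (hit (K i) p (- (x i * K' i))) (alg_act (K i) v).
Proof.
rewrite !dual_act_alg /alg_act /dual_act -(dd_actM V_module) (ddmul_x q_prim A_taft) !mulr1.
by rewrite !(linearDf (dd_actl V_module v)).
Qed.

Lemma dual_act_K i p v : dual_act p (alg_act (K i) v) =
  alg_act (K i) (dual_act (hit (K' i) p (K i)) v).
Proof.
rewrite alg_act_K_dual; congr (dual_act _ _); apply: dualP => y; rewrite !hitE.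
by rewrite !mulrA KK' mul1r -mulrA KK' mulr1.
Qed.

(** This is [alg_act_x_dual] for the form [hit (K' i) p 1], solved for the middle term, where that
    form becomes [p] again. Algebra elements now stand on the left wherever a weight form can absorb
    them. *)
Lemma dual_act_x i p v : dual_act p (alg_act (x i) v) =
  alg_act (x i) (dual_act (hit (K' i) p 1) v) - dual_act (hit (x i * K' i) p 1) v
  + dual_act (hit 1 p (x i * K' i)) (alg_act (K i) v).
Proof.
rewrite alg_act_x_dual.
have -> : hit (x i) (hit (K' i) p 1) 1 = hit (x i * K' i) p 1.
  by apply: dualP => y; rewrite !hitE !mul1r mulrA.
have -> : hit (K i) (hit (K' i) p 1) 1 = p.
  by apply: dualP => y; rewrite !hitE !mul1r -mulrA KK' mulr1.
have -> : hit (K i) (hit (K' i) p 1) (- (x i * K' i)) = - hit 1 p (x i * K' i).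
  apply: dualP => y; rewrite !hitE !lfun_simp hitE mul1r mulr1 !mulNr linearN /=.
  by rewrite -!mulrA KK' mulr1.
by rewrite (linearNf (dual_act_linl _)) addrAC subrK addrAC subrr add0r.
Qed.

Definition nonzero_form (f : V -> k^o) := linear f /\ exists v, f v != 0.

(** Composing [f] with the successive factors of the product eventually gives 0; the last nonzero
    form in this chain is killed by the next factor. [Q] records conditions that survive on the
    way. *)
Lemma refine_form (Q : (V -> k^o) -> Prop) (ts : seq A) :
  (forall f t, t \in ts -> linear f -> Q f -> Q (fun v => f (alg_act t v))) ->
  forall f, nonzero_form f -> Q f ->
  (forall v, f (alg_act (\prod_(t <- ts) t) v) = 0) ->
  exists f' t, [/\ t \in ts, nonzero_form f', Q f' & forall v, f' (alg_act t v) = 0].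
Proof.
elim: ts => [|t ts IHts] Qt f [f_lin [v fv]] Qf f0.
  by have := f0 v; rewrite big_nil alg_act1 => /eqP; rewrite (negPf fv).
have [[w ftw]|no_w] := classic (exists w, f (alg_act t w) != 0); last first.
  exists f, t; split=> //; first exact: mem_head; first by split=> //; exists v.
  by move=> w; apply/eqP/contraT => ftw; case: no_w; exists w.
have ft_lin : linear (fun v => f (alg_act t v)) by move=> c u u'; rewrite alg_act_linr f_lin.
have Qts f2 t2 : t2 \in ts -> linear f2 -> Q f2 -> Q (fun v => f2 (alg_act t2 v)).
  by move=> t2ts; apply: Qt; rewrite inE t2ts orbT.
have [|||f' [t' [t'ts f'_nz Qf' f't']]] := IHts Qts (fun v => f (alg_act t v)).
- by split=> //; exists w.
- by apply: Qt => //; apply: mem_head.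
- by move=> u; have := f0 u; rewrite big_cons alg_actM.
by exists f', t'; split=> //; rewrite inE t'ts orbT.
Qed.

(** Evaluation at [K i] of the factorization of X^l - 1 over the powers of the primitive root
    [q]. *)
Lemma prod_K_sub i : \prod_(t <- [seq K i - (q ^+ a)%:A | a <- iota 0 l]) t = 0.
Proof.
have H := congr1 (horner_alg (K i)) (factor_Xn_sub_1 q_prim).
rewrite rmorphB rmorphXn /= rmorph1 horner_algX (taftKl (taft_rel A_pres)) subrr in H.
rewrite big_map -[RHS]H rmorph_prod /index_iota subn0; apply: eq_bigr => a _.
by rewrite rmorphB /= horner_algX horner_algC.
Qed.

Lemma weight_form (f : V -> k^o) : nonzero_form f ->
  exists (f' : V -> k^o) (a : box n l), [/\ nonzero_form f',
    forall i v, f' (alg_act (K i) v) = q ^+ (a 0 i : nat) * f' v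
    & forall i v, f' (alg_act (x i) v) = 0].
Proof.
move=> f_nz.
have [f1 [f1_nz f1x]] : exists f1, nonzero_form f1 /\
    forall i v, f1 (alg_act (x i) v) = 0.
  suff [f1 [f1_nz f1x]] : exists f1, nonzero_form f1 /\
      forall i, i \in index_enum 'I_n -> forall v, f1 (alg_act (x i) v) = 0.
    by exists f1; split=> // i v; apply: f1x; apply: mem_index_enum.
  elim: (index_enum _) => [|i r [f1 [f1_nz f1x]]]; first by exists f.
  (* Composing with [x i] keeps a form killed by [x j], since x_i x_j is a multiple of x_j x_i. *)
  have Qx (f2 : V -> k^o) t : t \in nseq l (x i) -> linear f2 ->
      (forall j, j \in r -> forall v, f2 (alg_act (x j) v) = 0) ->
      forall j, j \in r -> forall v, f2 (alg_act t (alg_act (x j) v)) = 0.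
    rewrite mem_nseq => /andP[_ /eqP ->] f2_lin f2x j jr v.
    rewrite -alg_actM (taftxx (taft_rel A_pres)) (linearZf (alg_act_linl v)) alg_actM.
    by rewrite linearZf // f2x // scaler0.
  have [|f2 [t [ti f2_nz f2x f2t]]] := refine_form Qx f1_nz f1x.
    move=> v; have -> m : \prod_(t <- nseq m (x i)) t = x i ^+ m.
      by elim: m => [|m IHm]; rewrite /= ?big_nil // big_cons IHm exprS.
    rewrite (taftxl (taft_rel A_pres)) (linear0f (alg_act_linl v)).
    by rewrite linear0f //; case: f1_nz.
  exists f2; split=> // j; rewrite inE => /predU1P[-> |]; last exact: f2x.
  by move: ti; rewrite mem_nseq => /andP[_ /eqP <-].
pose Q (r : seq 'I_n) (f : V -> k^o) := (forall i v, f (alg_act (x i) v) = 0) /\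
  forall i, i \in r -> exists a : 'I_l, forall v, f (alg_act (K i) v) = q ^+ a * f v.
suff [f2 [f2_nz [f2x f2K]]] : exists f2, nonzero_form f2 /\ Q (index_enum 'I_n) f2.
  have /fin_all_exists[a aP] i := f2K i (mem_index_enum i).
  exists f2, (\row_i a i); split=> // i v; by rewrite aP mxE.
elim: (index_enum _) => [|i r [f2 [f2_nz f2Q]]]; first by exists f1.
(* Composing with K_i - q^a preserves all earlier conditions, because [K i] skew-commutes with each
   [x j] and commutes with each [K j]. *)
have QK f3 t : t \in [seq K i - (q ^+ a)%:A | a <- iota 0 l] -> linear f3 ->
    Q r f3 -> Q r (fun v => f3 (alg_act t v)).
  move=> /mapP[a _ ->] f3_lin [f3x f3K].
  have f3t v : f3 (alg_act (K i - (q ^+ a)%:A) v) = f3 (alg_act (K i) v) - q ^+ a * f3 v.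
    rewrite (linearDf (alg_act_linl v)) (linearNf (alg_act_linl v)) (linearZf (alg_act_linl v)).
    by rewrite alg_act1 linearDf // linearNf // linearZf.
  split=> [j v|j jr].
    rewrite f3t f3x mulr0 subr0 -alg_actM (Kx A_pres) (linearZf (alg_act_linl v)) alg_actM.
    by rewrite linearZf // f3x scaler0.
  have [b f3Kj] := f3K j jr; exists b => v.
  rewrite !f3t f3Kj -alg_actM (taftKC (taft_rel A_pres)) alg_actM f3Kj mulrBr.
  by congr (_ - _); rewrite mulrCA.
have [|f3 [t [/mapP[a a_lt tE] f3_nz f3Q f3t]]] := refine_form QK f2_nz f2Q.
  by move=> v; rewrite prod_K_sub (linear0f (alg_act_linl v)) linear0f //; case: f2_nz.
exists f3; split=> //; have [f3x f3K] := f3Q; split=> // j.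
rewrite inE => /predU1P[-> |]; last exact: f3K.
move: a_lt; rewrite mem_iota add0n => /= a_lt; exists (Ordinal a_lt) => v.
have [f3_lin _] := f3_nz; have := f3t v; rewrite tE.
rewrite (linearDf (alg_act_linl v)) (linearNf (alg_act_linl v)) (linearZf (alg_act_linl v)).
by rewrite alg_act1 linearDf // linearNf // linearZf // => /eqP; rewrite subr_eq0 => /eqP.
Qed.

Hypothesis V_simple : dd_simple act.

(** A nonzero v0 generates [V], so [V] is the double modulo the annihilator of v0. That subspace
    misses the unit, and a form on the double that kills it but not the unit descends to [V]. *)
Lemma exists_nonzero_form : exists f : V -> k^o, nonzero_form f.
Proof.
have [[v0 v0_nz] V_irr] := V_simple.
have phi_lin : linear (act^~ v0) by apply: (dd_actl V_module).
have [|||V0|V_cyc] := V_irr (fun v => exists d, act d v0 = v).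
- by exists 0; apply: linear0f phi_lin.
- by move=> a _ _ [d <-] [e <-]; exists (a *: d + e); apply: phi_lin.
- by move=> d _ [e <-]; exists (ddmul S d e); apply: (dd_actM V_module).
- by case/eqP: v0_nz; apply: V0; exists (dd1 S); apply: (dd_act1 V_module).
have [N kerN] := kernel_vspace phi_lin.
have [|p pN p1] := @exists_form _ _ N (dd1 S).
  apply: contra v0_nz => /kerN; rewrite (dd_act1 V_module) => ->; exact: eqxx.
have ex_d v : exists d, act d v0 == v by have [d <-] := V_cyc v; exists d.
(* The value does not depend on the chosen representative, because [p] vanishes on the annihilator
   [N]. *)
pose f v : k^o := p (xchoose (ex_d v)).
have fE d : f (act d v0) = p d.
  have /pN : xchoose (ex_d (act d v0)) - d \in N.
    apply/kerN; rewrite (linearDf phi_lin) (linearNf phi_lin).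
    by rewrite (eqP (xchooseP (ex_d _))) subrr.
  by rewrite linearB => /eqP; rewrite subr_eq0 => /eqP.
exists f; split=> [c u v|]; last by exists (act (dd1 S) v0); rewrite fE.
by have [[d <-] [e <-]] := (V_cyc u, V_cyc v); rewrite -(phi_lin c) !fE linearP.
Qed.

End DoubleModule.

(** * Right coideals *)

Section RightCoideals.
Variables (k : fieldType) (n l : nat) (q : k) (q_prim : l.-primitive_root q).
Variables (A : falgType k) (S : hopf_algebra A) (K K' x : 'I_n -> A).
Hypothesis A_taft : taft_hopf l q S K K' x.

Let A_pres := taft_pres A_taft.

(** The action of the dual on H_chi; a subspace stable under it for all [p] is a right coideal. *)
Definition coact_by (p : dual A) (a : A) : A :=
  sweedler2 S (fun a1 a2 => (p a2 : k) *: a1) a.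

Lemma coact_bilinear (p : dual A) :
  bilinear_fun (fun a1 a2 : A => (p a2 : k) *: a1).
Proof.
split=> b c u v; first by rewrite linearP.
by rewrite linearP scalerDl scalerA.
Qed.

Lemma coact_lin p : linear (coact_by p). Proof. exact: sweedler_lin. Qed.

Lemma coact_1 p : coact_by p 1 = p 1 *: 1.
Proof. by rewrite /coact_by sweedler_1 //; apply: coact_bilinear. Qed.

Lemma coact_KM p i a : coact_by p (K i * a) = K i * coact_by (hit 1 p (K i)) a.
Proof.
rewrite /coact_by (sweedler_KM A_taft) //; last exact: coact_bilinear.
rewrite (sweedler_comp S _ _ (L := fun u => K i * u)); last first.
  by move=> c u v; rewrite mulrDr scalerAr.
by apply: eq_sweedler => a1 a2; rewrite hitE mulr1 scalerAr.
Qed.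

Lemma coact_xM p i a : coact_by p (x i * a) =
  x i * coact_by p a + K i * coact_by (hit 1 p (x i)) a.
Proof.
rewrite /coact_by (sweedler_xM A_taft) //; last exact: coact_bilinear.
rewrite sweedlerD (sweedler_comp S _ _ (L := fun u => x i * u)); last first.
  by move=> c u v; rewrite mulrDr scalerAr.
rewrite (sweedler_comp S _ _ (L := fun u => K i * u)); last first.
  by move=> c u v; rewrite mulrDr scalerAr.
by congr (_ + _); apply: eq_sweedler => a1 a2; rewrite ?hitE ?mulr1 scalerAr.
Qed.

(* [fil m] is spanned by the monomials of degree less than m in the x i.      *)
Inductive fil : nat -> A -> Prop :=
| fil_0 m : fil m 0
| fil_lin m (c : k) u v : fil m u -> fil m v -> fil m (c *: u + v)
| fil_1 m : fil m.+1 1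
| fil_K m i a : fil m a -> fil m (K i * a)
| fil_x m i a : fil m a -> fil m.+1 (x i * a).

Lemma fil0_eq0 a : fil 0 a -> a = 0.
Proof.
move: {-2}0%N (erefl 0%N) => m m0 fa; elim: fa m0 => // {m a}.
- by move=> m c u v _ IHu _ IHv m0; rewrite IHu // IHv // scaler0 addr0.
- by move=> m i a _ IH m0; rewrite IH // mulr0.
Qed.

Lemma filS m a : fil m a -> fil m.+1 a.
Proof.
elim=> {m a} [m|m c u v _ IHu _ IHv|m|m i a _ IH|m i a _ IH].
- exact: fil_0.
- exact: fil_lin.
- exact: fil_1.
- exact: fil_K.
- exact: fil_x.
Qed.

Lemma fil_le m m' a : (m <= m')%N -> fil m a -> fil m' a.
Proof.
by move/subnK <-; elim: (m' - m)%N => // d IHd fa; apply/filS/IHd.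
Qed.

Lemma filD m u v : fil m u -> fil m v -> fil m (u + v).
Proof. by move=> fu fv; rewrite -[u]scale1r; apply: fil_lin. Qed.

Lemma filZ m c u : fil m u -> fil m (c *: u).
Proof. by move=> fu; rewrite -[_ *: _]addr0; apply: fil_lin => //; apply: fil_0. Qed.

Lemma fil_exhaustive a : exists m, fil m a.
Proof.
move: a; apply: (taft_ind q_prim A_pres) =>
  [c u v [m fu] [m' fv]||i a [m fa]|i a [m fa]].
- exists (maxn m m'); apply: fil_lin.
    exact: fil_le (leq_maxl _ _) fu.
  exact: fil_le (leq_maxr _ _) fv.
- exists 1%N; exact: fil_1.
- by exists m; apply: fil_K.
- by exists m.+1; apply: fil_x.
Qed.

(** [fil 1] is the degree 0 part, the group algebra of the [K i]. *)
Definition kills_torus (p : dual A) := forall a, fil 1 a -> p a = 0.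

(** The degrees of the two factors of the coproduct add up to at most that of [a]. A form killing
    degree 0 forces positive degree in the second factor, so the first one drops. *)
Lemma coact_fil m a : fil m a ->
  forall p, fil m (coact_by p a) /\ (kills_torus p -> fil m.-1 (coact_by p a)).
Proof.
elim=> {m a} [m|m c u v _ IHu _ IHv|m|m i a _ IH|m i a fa IH] p.
- by rewrite (linear0f (coact_lin p)); split=> *; apply: fil_0.
- rewrite (coact_lin p); split=> [|pJ]; apply: fil_lin.
  + exact: (IHu p).1.
  + exact: (IHv p).1.
  + exact: (IHu p).2.
  + exact: (IHv p).2.
- rewrite coact_1; split=> [|pJ]; first by apply/filZ/fil_1.
  by rewrite pJ ?scale0r; [apply: fil_0 | apply: fil_1].
- rewrite coact_KM; split=> [|pJ]; apply: fil_K; first exact: (IH _).1.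
  apply: (IH _).2 => b fb; rewrite hitE mulr1; apply: pJ; exact: fil_K.
- rewrite coact_xM; split=> [|pJ /=].
    apply: filD; first by apply: fil_x; apply: (IH p).1.
    by apply/fil_K/filS; apply: (IH _).1.
  apply: filD; last by apply: fil_K; apply: (IH _).1.
  (* [fil_x] raises the index by one, so index 0 is treated apart; there [a] is 0. *)
  case: m fa IH => [/fil0_eq0 -> _|m fa IH].
    by rewrite (linear0f (coact_lin p)) mulr0; apply: fil_0.
  by apply: fil_x; apply: (IH p).2.
Qed.

Lemma coact_Kmon p (b : box n l) :
  coact_by p (Kmon K (box_val b)) = p (Kmon K (box_val b)) *: Kmon K (box_val b).
Proof.
rewrite KmonE -[\prod_i _]mulr1; move: p.
apply: (@prod_pow_ind _ A _ K (fun i => b 0 i : nat)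
  (fun g => forall p, coact_by p g = p g *: g)) => [i g IHg|] p.
  by rewrite coact_KM IHg -scalerAr hitE mulr1.
exact: coact_1.
Qed.

Lemma Kmon_neq0 (b : box n l) : Kmon K (box_val b) != 0.
Proof.
suff : counit S (Kmon K (box_val b)) = 1.
  by move=> e1; apply: contra_eq_neq e1 => ->; rewrite linear0 eq_sym oner_neq0.
rewrite KmonE -[\prod_i _]mulr1.
apply: (@prod_pow_ind _ A _ K (fun i => b 0 i : nat)
  (fun g => counit S g = 1)) => [i g IHg|]; last exact: counit1.
by rewrite counitM (taft_counitK A_taft) IHg mulr1.
Qed.

Let torus : {vspace A} := <<[seq Kmon K (box_val b) | b : box n l]>>%VS.

Lemma torus_KM i a : a \in torus -> K i * a \in torus.
Proof.
move: a; apply: span_ind => [|c u v IHu IHv|_ /imageP[b _ ->]].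
- by rewrite mulr0 mem0v.
- by rewrite mulrDr -scalerAr memvD ?memvZ.
- have [s [b' ->]] := K_mul_Kmon q_prim A_pres i b.
  by apply/memvZ/memv_span/image_f.
Qed.

Lemma fil1_torus a : fil 1 a -> a \in torus.
Proof.
move: {-2}1%N (erefl 1%N) => m m1 fa; elim: fa m1 => {m a}
  [m|m c u v _ IHu _ IHv|m|m i a _ IH|m i a fa _] m1.
- exact: mem0v.
- by rewrite memvD ?memvZ ?IHu ?IHv.
- have [b bE] := Km_box q_prim A_pres (fun=> 0%N).
  have <- : Kmon K (box_val b) = 1 by rewrite -bE big1.
  by apply/memv_span/image_f.
- exact/torus_KM/IH.
- by case: m1 fa => -> /fil0_eq0 ->; rewrite mulr0 mem0v.
Qed.

(** The coordinate form at K(b) acts as the projection onto the K(b)-component, and a nonzero [a]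
    has a nonzero component. *)
Lemma torus_component a : a \in torus -> a != 0 ->
  exists p (s : k) (b : box n l), s != 0 /\ coact_by p a = s *: Kmon K (box_val b).
Proof.
pose c0 := box0 n (prim_gt0 q_prim); pose e := taft_coord K x c0.
have e_K b b' : coact_by (e b) (Kmon K (box_val b')) =
    (b' == b)%:R *: Kmon K (box_val b').
  rewrite coact_Kmon; congr (_ *: _).
  rewrite -[Kmon K _]mul1r (_ : 1 = xmon x c0); last first.
    by rewrite /xmon big1 // => i _; rewrite mxE.
  by rewrite (taft_coordE q_prim A_pres) xpair_eqE eqxx.
move=> aT a_nz.
have [aE aK] : a = \sum_b coact_by (e b) a /\
    forall b, exists s, coact_by (e b) a = s *: Kmon K (box_val b).
  move: a aT {a_nz}; apply: span_ind => [|s u v [uE uK] [vE vK]|_ /imageP[b' _ ->]].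
  - split=> [|b]; last by exists 0; rewrite (linear0f (coact_lin _)) scale0r.
    by rewrite big1 // => b _; rewrite (linear0f (coact_lin _)).
  - split=> [|b].
      rewrite {1}uE {1}vE scaler_sumr -big_split; apply: eq_bigr => b _ /=.
      by rewrite (coact_lin (e b)).
    have [[s1 us1] [s2 vs2]] := (uK b, vK b); exists (s * s1 + s2).
    by rewrite (coact_lin (e b)) us1 vs2 scalerA scalerDl.
  - split=> [|b].
      rewrite (bigD1 b') //= e_K eqxx scale1r big1 ?addr0 // => b /negPf ne_b.
      by rewrite e_K eq_sym ne_b scale0r.
    rewrite e_K; case: eqVneq => [->|_]; first by exists 1.
    by exists 0; rewrite !scale0r.
have [b b_nz] : exists b, coact_by (e b) a != 0.
  apply/existsP; apply: contraNT a_nz; rewrite negb_exists => /forallP a0.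
  by rewrite aE big1 // => b _; apply/eqP/negPn/a0.
have [s sE] := aK b; exists (e b), s, b; split=> //.
by apply: contraNneq b_nz => s0; rewrite sE s0 scale0r.
Qed.

(* If p kills the torus, p acts as 0 on a nonzero vector of least filtration  *)
(* degree; such a vector lies in the torus, and one of its components is a    *)
(* group-like element.                                                        *)
Lemma coideal_grouplike (R : A -> Prop) :
  (forall p a, R a -> R (coact_by p a)) -> (forall (c : k) a, R a -> R (c *: a)) ->
  (exists2 a, R a & a != 0) -> exists b : box n l, R (Kmon K (box_val b)).
Proof.
move=> R_co R_Z [a0 Ra0 a0_nz].
have [a Ra [a_nz aJ]] : exists2 a, R a & a != 0 /\
    forall p, kills_torus p -> coact_by p a = 0.
  have [m fa0] := fil_exhaustive a0.
  elim: m a0 Ra0 a0_nz fa0 => [|m IHm] a Ra a_nz fa.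
    by rewrite (fil0_eq0 fa) eqxx in a_nz.
  have [[p [pJ pa_nz]]|no_p] := classic (exists p, kills_torus p /\ coact_by p a != 0).
    exact: IHm (R_co p a Ra) pa_nz ((coact_fil fa p).2 pJ).
  exists a => //; split=> // p pJ; apply/eqP/contraT => pa_nz.
  by case: no_p; exists p.
(* Otherwise some form [p] kills the torus but not [a]; yet p(a) is the counit of [coact_by p a],
   which is 0. *)
have aT : a \in torus.
  apply: contraT => /exists_form[p pT dual_act].
  case/eqP: dual_act; rewrite -[a in LHS](cop_counitl S a) (tlift_comp _ _ (linearP p)).
  transitivity (counit S (coact_by p a)); last first.
    by rewrite aJ ?linear0 // => b /fil1_torus; apply: pT.
  rewrite /coact_by (sweedler_comp S _ _ (linearP (counit S))).
  by apply: eq_tlift => u v; rewrite !linearZ; apply: mulrC.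
have [p [s [b [s_nz dual_act]]]] := torus_component aT a_nz.
exists b; rewrite -[Kmon _ _]scale1r -(mulVf s_nz) -scalerA -dual_act.
by apply/R_Z/R_co.
Qed.

End RightCoideals.

(** * The coefficient map *)

Section Bullet.
Variables (k : fieldType) (n l : nat) (q : k) (q_prim : l.-primitive_root q).
Variables (A : falgType k) (S : hopf_algebra A) (K K' x : 'I_n -> A).
Hypothesis A_taft : taft_hopf l q S K K' x.
Variables (chi : dual A).
Hypothesis chi1 : chi 1 = 1.
Hypothesis chiM : forall g h, chi (g * h) = (chi g : k) * chi h.
Hypothesis chix : forall i, chi (x i) = 0.

Lemma twistr_bilinear : bilinear_fun (fun a b : A => (chi a : k) *: b).
Proof.
split=> b c u v; first by rewrite linearP scalerDl scalerA.
by rewrite linearP.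
Qed.

Lemma twistr_lin : linear (fun h => twistr S h chi).
Proof. exact: sweedler_lin. Qed.

Lemma twistr1 : twistr S 1 chi = 1.
Proof. by rewrite /twistr sweedler_1 ?chi1 ?scale1r //; apply: twistr_bilinear. Qed.

Lemma twistr_KM i h : twistr S (K i * h) chi = chi (K i) *: (K i * twistr S h chi).
Proof.
rewrite /twistr (sweedler_KM A_taft) //; last exact: twistr_bilinear.
rewrite (sweedler_comp S _ _ (L := fun u => chi (K i) *: (K i * u))).
  by apply: eq_sweedler => a b; rewrite chiM -scalerAr scalerA.
by move=> c u v; rewrite mulrDr -scalerAr scalerDr !scalerA mulrC.
Qed.

(** Only the term with [K i] in the first factor of the coproduct survives, because [chi] kills
    [x i]. *)
Lemma twistr_xM i h : twistr S (x i * h) chi = chi (K i) *: (x i * twistr S h chi).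
Proof.
rewrite /twistr (sweedler_xM A_taft) //; last exact: twistr_bilinear.
rewrite (sweedler_comp S _ _ (L := fun u => chi (K i) *: (x i * u))).
  apply: eq_sweedler => a b.
  by rewrite !chiM chix mul0r scale0r add0r -scalerAr scalerA.
by move=> c u v; rewrite mulrDr -scalerAr scalerDr !scalerA mulrC.
Qed.

Lemma bullet_bilinear a :
  bilinear_fun (fun h1 h2 => twistr S h2 chi * a * sinv S h1).
Proof.
split=> b c u v; first by rewrite sinv_lin mulrDr -scalerAr.
by rewrite twistr_lin !mulrDl -!scalerAl.
Qed.

Lemma bullet_linl a : linear (fun h => bullet S chi h a).
Proof. exact: sweedler_lin. Qed.

Lemma bullet_linr h : linear (bullet S chi h).
Proof.
move=> c u v; rewrite /bullet -sweedler_comb; apply: eq_sweedler => a b.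
by rewrite mulrDr mulrDl -scalerAr -scalerAl.
Qed.

Lemma bullet1 a : bullet S chi 1 a = a.
Proof.
rewrite /bullet sweedler_1; last exact: bullet_bilinear.
by rewrite twistr1 (sinv1 q_prim A_taft) mul1r mulr1.
Qed.

Lemma bullet_KM i h a :
  bullet S chi (K i * h) a = chi (K i) *: (K i * bullet S chi h a * K' i).
Proof.
rewrite /bullet (sweedler_KM A_taft); last exact: bullet_bilinear.
rewrite (sweedler_comp S _ _ (L := fun u => chi (K i) *: (K i * u * K' i))).
  apply: eq_sweedler => b c.
  rewrite twistr_KM (sinvM q_prim A_taft) (sinv_K q_prim A_taft).
  by rewrite -!scalerAl !mulrA.
move=> c u v; rewrite mulrDr mulrDl -scalerAr -scalerAl.
by rewrite scalerDr !scalerA mulrC.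
Qed.

(** One term for each summand of the coproduct of [x i]; the sign comes from its inverse
    antipode. *)
Lemma bullet_xM i h a : bullet S chi (x i * h) a =
  chi (K i) *: (x i * bullet S chi h a * K' i) - bullet S chi h a * (x i * K' i).
Proof.
rewrite /bullet (sweedler_xM A_taft); last exact: bullet_bilinear.
rewrite sweedlerD addrC; congr (_ + _).
  rewrite (sweedler_comp S _ _ (L := fun u => chi (K i) *: (x i * u * K' i))).
    apply: eq_sweedler => b c.
    rewrite twistr_xM (sinvM q_prim A_taft) (sinv_K q_prim A_taft).
    by rewrite -!scalerAl !mulrA.
  move=> c u v; rewrite mulrDr mulrDl -scalerAr -scalerAl.
  by rewrite scalerDr !scalerA mulrC.
rewrite -mulrN (sweedler_comp S _ _ (L := fun u => u * (- (x i * K' i)))).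
  apply: eq_sweedler => b c.
  by rewrite (sinvM q_prim A_taft) (sinv_x q_prim A_taft) !mulrA.
by move=> c u v; rewrite mulrDl -scalerAl.
Qed.

End Bullet.

(** * The morphism from [V] to H_chi *)

Section CoefficientMap.
Variables (k : fieldType) (n l : nat) (q : k) (q_prim : l.-primitive_root q).
Variables (A : falgType k) (S : hopf_algebra A) (K K' x : 'I_n -> A).
Hypothesis A_taft : taft_hopf l q S K K' x.
Variables (V : lmodType k) (act : drinfeld A -> V -> V).
Hypothesis V_module : dd_module S act.
Variables (chi : dual A).
Hypothesis chi1 : chi 1 = 1.
Hypothesis chiM : forall g h, chi (g * h) = (chi g : k) * chi h.
Hypothesis chix : forall i, chi (x i) = 0.
Variable f : V -> k^o.
Hypothesis f_lin : linear f.
Hypothesis fK : forall i v, f (alg_act S act (K i) v) = (chi (K i) : k) * f v.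
Hypothesis fx : forall i v, f (alg_act S act (x i) v) = 0.

Let A_pres := taft_pres A_taft.
Let KK' := KK'K A_pres.
Let K'K := K'K A_pres.
Local Notation alg_act := (alg_act S act).
Local Notation dual_act := (dual_act act).

(* f(v_(0)) v_(1), the element of A = A^** that sends p to f (p . v).         *)
Definition coeff_map (v : V) : A :=
  \sum_(i < \dim {:A})
    (f (dual_act (linfun (coord (vbasis {:A}) i : A -> k^o)) v) : k) *:
      (vbasis {:A})`_i.

(** This characterizes [coeff_map v]; identities between its values are proved by testing them
    against all [p]. *)
Lemma coeff_mapE (p : dual A) v : p (coeff_map v) = f (dual_act p v).
Proof.
have pE : p = \sum_(i < \dim {:A}) (p (vbasis {:A})`_i : k) *:
    (linfun (coord (vbasis {:A}) i : A -> k^o) : dual A).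
  apply: dualP => a; rewrite sum_lfunE {1}(coord_vbasis (memvf a)) linear_sum.
  apply: eq_bigr => i _; rewrite linearZ lfun_simp (linfunP (linearP _)).
  exact: mulrC.
rewrite {2}pE (linear_sumf (dual_act_linl V_module v)) (linear_sumf f_lin).
rewrite /coeff_map linear_sum; apply: eq_bigr => i _.
by rewrite linearZ (linearZf (dual_act_linl V_module v)) linearZf //; apply: mulrC.
Qed.

Lemma coeff_map_lin : linear coeff_map.
Proof.
move=> c u v; apply: dual_ext => p.
by rewrite linearP /= !coeff_mapE (dual_act_linr V_module) f_lin.
Qed.

Lemma coeff_map_dual_act p v : coeff_map (dual_act p v) = coact_by S p (coeff_map v).
Proof.
apply: dual_ext => r; rewrite coeff_mapE (dual_actM q_prim A_taft V_module) -coeff_mapE convE.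
rewrite /coact_by (sweedler_comp S _ _ (linearP r)); apply: eq_sweedler => a b.
by rewrite linearZ; apply: mulrC.
Qed.

Lemma coeff_map_K i v :
  coeff_map (alg_act (K i) v) = chi (K i) *: (K i * coeff_map v * K' i).
Proof.
apply: dual_ext => p; rewrite coeff_mapE (dual_act_K q_prim A_taft V_module) fK.
by rewrite -coeff_mapE hitE linearZ.
Qed.

(** Of the three terms of [dual_act_x], the first dies because [f] kills the image of [x i]. The
    result matches the recursion [bullet_xM]. *)
Lemma coeff_map_x i v : coeff_map (alg_act (x i) v) =
  chi (K i) *: (x i * coeff_map v * K' i) - coeff_map v * (x i * K' i).
Proof.
apply: dual_ext => p; rewrite coeff_mapE (dual_act_x q_prim A_taft V_module).
rewrite !(linearDf f_lin) (linearNf f_lin) fx add0r -!coeff_mapE !hitE mul1r.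
rewrite coeff_map_K mulr1 addrC linearB linearZ /=; congr (_ - _).
rewrite -scalerAr linearZ /= !mulrA -[x i * K' i * K i]mulrA K'K.
by rewrite mulr1.
Qed.

Lemma coeff_map_alg_act h v : coeff_map (alg_act h v) = bullet S chi h (coeff_map v).
Proof.
move: h; apply: (taft_ind q_prim A_pres) => [c g h IHg IHh||i h IH|i h IH].
- by rewrite (alg_act_linl V_module) coeff_map_lin IHg IHh bullet_linl.
- by rewrite (alg_act1 V_module) (bullet1 q_prim A_taft).
- by rewrite (alg_act_KM q_prim A_taft V_module) coeff_map_K IH (bullet_KM q_prim A_taft).
- by rewrite (alg_act_xM q_prim A_taft V_module) coeff_map_x IH (bullet_xM q_prim A_taft).
Qed.

Lemma Hchi_dact_tens p h a :
  Hchi_dact S chi (tens p h) a = coact_by S p (bullet S chi h a).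
Proof.
rewrite /Hchi_dact /yd_dact tlift_tens // => [g|r] c u v; last first.
  by rewrite bullet_linl linearP tlift_is_linear.
rewrite -tlift_lin; apply: eq_tlift => m0 m1.
by rewrite !lfun_simp scalerDl scalerA.
Qed.

Lemma coeff_map_act d v : coeff_map (act d v) = Hchi_dact S chi d (coeff_map v).
Proof.
have dact_lin : linear (fun d => Hchi_dact S chi d (coeff_map v)).
  exact: tlift_is_linear.
move: d; apply: tensor_ind => [|c d d' IHd IHd'|p h].
- rewrite (linear0f dact_lin) (linear0f (dd_actl V_module v)).
  by rewrite (linear0f coeff_map_lin).
- by rewrite (dd_actl V_module) coeff_map_lin dact_lin IHd IHd'.
- rewrite -(dual_act_alg q_prim A_taft V_module) coeff_map_dual_act coeff_map_alg_act.
  by rewrite Hchi_dact_tens.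
Qed.

Hypothesis f_nz : exists v, f v != 0.
Hypothesis V_simple : dd_simple act.

(** The kernel is a submodule, hence zero or all of [V]; the latter is excluded since the counit of
    [coeff_map v] is f v. *)
Lemma coeff_map_inj : injective coeff_map.
Proof.
have [_ V_irr] := V_simple.
have [|||ker0|kerT] := V_irr (fun v => coeff_map v = 0).
- exact: linear0f coeff_map_lin.
- by move=> c u v u0 v0; rewrite coeff_map_lin u0 v0 scaler0 addr0.
- move=> d v v0; rewrite coeff_map_act v0; move: d.
  have dact_lin : linear (fun d => Hchi_dact S chi d 0) by apply: tlift_is_linear.
  apply: tensor_ind => [|c d d' IHd IHd'|p h]; first exact: linear0f dact_lin.
    by rewrite dact_lin IHd IHd' scaler0 addr0.
  by rewrite Hchi_dact_tens (linear0f (bullet_linr _ _ _)) (linear0f (coact_lin _ _)).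
- move=> u v eq_uv; apply/eqP; rewrite -subr_eq0; apply/eqP/ker0.
  by rewrite (linearDf coeff_map_lin) (linearNf coeff_map_lin) eq_uv subrr.
- have [v /eqP[]] := f_nz; have := coeff_mapE (counit S) v.
  by rewrite kerT linear0 -[dual_act _ _]/(alg_act 1 v) (alg_act1 V_module).
Qed.

(** The orbit A v0 is stable under the dual: [dual_act_K] and [dual_act_x] move forms past the
    generators until they reach v0, which they only rescale. By simplicity it is all of [V]. *)
Lemma alg_act_generates g v0 : g != 0 -> (forall p : dual A, coact_by S p g = p g *: g) ->
  coeff_map v0 = g -> forall v, exists h, v = alg_act h v0.
Proof.
move=> g_nz g_gl v0E.
have [[u0 u0_nz] V_irr] := V_simple.
have W_lin c u v : (exists h, u = alg_act h v0) -> (exists h, v = alg_act h v0) ->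
    exists h, c *: u + v = alg_act h v0.
  by move=> [h ->] [h' ->]; exists (c *: h + h'); rewrite (alg_act_linl V_module).
have W_ha g' u : (exists h, u = alg_act h v0) -> exists h, alg_act g' u = alg_act h v0.
  by move=> [h ->]; exists (g' * h); rewrite (alg_actM q_prim A_taft V_module).
have W0 : exists h, 0 = alg_act h v0 by exists 0; rewrite (linear0f (alg_act_linl V_module _)).
have W_pa h : forall p, exists h', dual_act p (alg_act h v0) = alg_act h' v0.
  move: h; apply: (taft_ind q_prim A_pres) => [c u v IHu IHv p||i h IH p|i h IH p].
  - by rewrite (alg_act_linl V_module) (dual_act_linr V_module); apply: W_lin.
  (* As g is group-like and the map is injective, [p] multiplies v0 by p g. *)
  - move=> p; rewrite (alg_act1 V_module); exists (p g)%:A; apply: coeff_map_inj.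
    rewrite coeff_map_dual_act v0E g_gl (linearZf (alg_act_linl V_module _)) (alg_act1 V_module).
    by rewrite (linearZf coeff_map_lin) v0E.
  - rewrite (alg_act_KM q_prim A_taft V_module) (dual_act_K q_prim A_taft V_module).
    exact/W_ha/IH.
  - rewrite (alg_act_xM q_prim A_taft V_module) (dual_act_x q_prim A_taft V_module).
    rewrite -[X in X + _]scale1r; apply: (W_lin).
      rewrite addrC -scaleN1r; apply: (W_lin); first exact: IH.
      exact/W_ha/IH.
    by rewrite (dual_act_K q_prim A_taft V_module); apply/W_ha/IH.
have [|||V0|//] := V_irr (fun v => exists h, v = alg_act h v0).
- exact: W0.
- exact: W_lin.
- move=> d v Wv; move: d; apply: tensor_ind => [|c d d'|p h].
  + by rewrite (linear0f (dd_actl V_module _)).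
  + by rewrite (dd_actl V_module); apply: W_lin.
  + by rewrite -(dual_act_alg q_prim A_taft V_module); have [h' ->] := W_ha h v Wv.
- have /V0 v00 : exists h, v0 = alg_act h v0 by exists 1; rewrite (alg_act1 V_module).
  by move: g_nz; rewrite -v0E v00 (linear0f coeff_map_lin) eqxx.
Qed.

End CoefficientMap.

(** * Identification of the image with H_(chi,g) *)

Theorem theorem5p1 (k : closedFieldType) (char0 : [pchar k] =i pred0)
  (n l : nat) (n_ge1 : (1 <= n)%N) (l_odd : odd l)
  (q : k) (q_prim : l.-primitive_root q)
  (A : falgType k) (S : hopf_algebra A) (K K' x : 'I_n -> A)
  (A_taft : taft_hopf l q S K K' x)
  (V : lmodType k) (act : drinfeld A -> V -> V)
  (V_module : dd_module S act) (V_simple : dd_simple act) :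
  exists a b : box n l,
    dd_iso_Hchig S act (Kdual l q K x (box_val a)) (Kmon K (box_val b)).
Proof.
have [f0 f0_nz] := exists_nonzero_form V_module V_simple.
have [f [a [[f_lin f_nz] fK fx]]] := weight_form q_prim A_taft V_module f0_nz.
have [g [chiE gK gx]] := Kdual_char q_prim (taft_pres A_taft) a.
set chi := Kdual l q K x (box_val a) in chiE.
have chi1 : chi 1 = 1 by rewrite chiE rmorph1.
have chiM u v : chi (u * v) = (chi u : k) * chi v by rewrite !chiE rmorphM.
have chix i : chi (x i) = 0 by rewrite chiE gx.
have fK' i v : f (alg_act S act (K i) v) = (chi (K i) : k) * f v.
  by rewrite chiE gK fK.
have F_lin := coeff_map_lin V_module f_lin.
have F_inj := coeff_map_inj q_prim A_taft V_module chi1 chiM chix f_lin fK' fx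
  f_nz V_simple.
have F_ha := coeff_map_alg_act q_prim A_taft V_module chi1 chiM chix f_lin fK' fx.
have F_act := coeff_map_act q_prim A_taft V_module chi1 chiM chix f_lin fK' fx.
have F_pa := coeff_map_dual_act q_prim A_taft V_module f_lin.
set F := coeff_map act f in F_lin F_inj F_ha F_act F_pa.
(* The coideal considered is the image of [F], which is stable under the dual by [F_pa]. *)
have [|||b [v0 v0E]] := @coideal_grouplike _ _ _ _ q_prim _ _ _ _ _
    A_taft (fun u => exists v, F v = u).
- by move=> p _ [v <-]; exists (dual_act act p v); rewrite F_pa.
- by move=> c _ [v <-]; exists (c *: v); rewrite (linearZf F_lin).
- have [v fv] := f_nz; exists (F v); first by exists v.
  apply: contraNneq fv => Fv0; rewrite (_ : v = 0) ?(linear0f f_lin) //.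
  by apply: F_inj; rewrite Fv0 (linear0f F_lin).
have V_gen := alg_act_generates q_prim A_taft V_module chi1 chiM chix f_lin fK' fx
  f_nz V_simple (Kmon_neq0 A_taft b) (coact_Kmon A_taft ^~ b) v0E.
exists a, b.
have mem_Hchig h : bullet S chi h (Kmon K (box_val b)) \in
    Hchig S chi (Kmon K (box_val b)).
  rewrite -(linfunP (bullet_linl S chi (Kmon K (box_val b)))).
  exact/memv_img/memvf.
have F_mem v : F v \in Hchig S chi (Kmon K (box_val b)).
  by have [h ->] := V_gen v; rewrite F_ha v0E.
pose G v : subvs_of (Hchig S chi (Kmon K (box_val b))) := vsproj _ (F v).
have G_lin : linear G by move=> c u v; rewrite /G F_lin linearP.
pose G' : {linear V -> subvs_of (Hchig S chi (Kmon K (box_val b)))} :=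
  HB.pack G (GRing.isLinear.Build k V _ _ G G_lin).
exists G'; split=> [|d v]; last by rewrite /= /G !vsprojK // F_act.
(* An element of H_(chi,g) is h acting on g for some h, hence the image of h v0. *)
have G_surj w : exists v, G v == w.
  have /memv_imgP[h _ wE] := subvsP w.
  exists (alg_act S act h v0); apply/eqP/val_inj.
  rewrite /= vsprojK // F_ha v0E wE.
  by rewrite (linfunP (bullet_linl S chi _)).
have G_inj : injective G.
  by move=> u v /(congr1 vsval); rewrite !vsprojK //; apply: F_inj.
exists (fun w => xchoose (G_surj w)) => [v | w].
  by apply: G_inj; apply/eqP/(xchooseP (G_surj _)).
exact/eqP/(xchooseP (G_surj w)).
Qed.
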